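(* Let $\epsilon>0$ be a constant and consider Boolean functions $f\colon\{0,1\}^n\to\{0,1\}$ (for the asymptotic items, a family $(f_n)_n$). (1) If $\mathrm{Cor}(f,16)\le 2^{-n(1-\epsilon)}$, then $s(f)\ge 3.9(1-\epsilon)n-4$. (2) If for every constant integer $d$, $\mathrm{Cor}(f_n,d)\le 2^{-\epsilon n}$ for all sufficiently large $n$ (i.e. $\mathrm{Cor}(f,\omega(1))\le 2^{-\epsilon n}$), then $s_{\mathrm{sp}}(f)=\omega(n)$. (3) If for every constant $\eta>0$, $\mathrm{Cor}(f_n,2^{(\log n)^{1-\eta}})\le 2^{-\epsilon n}$ for all sufficiently large $n$ (i.e. $\mathrm{Cor}(f,2^{(\log n)^{1-o(1)}})\le 2^{-\epsilon n}$), then $s_{\log}(f)=\omega(n)$. (4) If for every constant $C>0$, $\mathrm{Cor}(f_n,n^{\epsilon})\le 2^{-Cn/\log\log n}$ for all sufficiently large $n$ (i.e. $\mathrm{Cor}(f,n^\epsilon)\le 2^{-\omega(n/\log\log n)}$), then $s_{\log}(f)=\omega(n)$.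
   Context: For $f,g\colon\{0,1\}^n\to\{0,1\}$, $\mathrm{Cor}(f,g)=|\Pr_x[f(x)=g(x)]-\Pr_x[f(x)\ne g(x)]|$ with $x$ uniform, and $\mathrm{Cor}(f,d)=\max_g\mathrm{Cor}(f,g)$ over polynomials $g$ over $\mathbb{F}_2$ of degree at most $d$. Circuits are Boolean circuits over all binary Boolean operations (fan-in 2), with size = number of internal gates; $s(f)$ is the minimum size of a circuit computing $f$. $s_{\mathrm{sp}}(f)=\omega(n)$ means: for every constant $c$, for all large $n$, $f_n$ has no series-parallel circuit of size at most $cn$, where a circuit is series-parallel if its underlying DAG $(V,E)$ has a labeling $\ell\colon V\to\mathbb{N}$ with $\ell(u)<\ell(v)$ for every edge $(u,v)$ and with no two edges $(u,v),(u',v')$ satisfying $\ell(u)<\ell(u')<\ell(v)<\ell(v')$. $s_{\log}(f)=\omega(n)$ means: for every constant $c$, for all large $n$, $f_n$ has no circuit of size at most $cn$ and depth at most $c\log n$. *)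

(* Defs.v *)
From HB Require Import structures.
From mathcomp Require Import all_boot all_order all_algebra.
From mathcomp Require Import all_classical all_reals all_analysis.
(* The notations of [mpoly] clash with those of [analysis]. *)
From mathcomp Require Import -(notations) mpoly.

Set Implicit Arguments.
Unset Strict Implicit.
Unset Printing Implicit Defensive.

Import Order.TTheory GRing.Theory Num.Theory.

Local Open Scope classical_set_scope.
Local Open Scope ring_scope.

Definition boolfun (n : nat) := n.-tuple bool -> bool.

Definition log2 (R : realType) (x : R) : R := ln x / ln 2.

Section Correlation.
Variables (R : realType) (n : nat).
Implicit Types f g : boolfun n.

Definition Pr (P : pred (n.-tuple bool)) : R :=
  #|[set x | P x]%SET|%:R / #|{: n.-tuple bool}|%:R.

Definition Cor f g : R :=
  `|Pr (fun x => f x == g x) - Pr (fun x => f x != g x)|.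

(* [msize p] is the total degree of [p] plus one, and 0 if [p = 0]. *)
Definition mpoly_degree (p : mpoly.mpoly n 'F_2) : nat :=
  (mpoly.msize p).-1.

Definition represents (p : mpoly.mpoly n 'F_2) g : Prop :=
  forall x : n.-tuple bool,
    meval (fun i => (tnth x i)%:R) p = (g x)%:R :> 'F_2.

(* The degree bound [d] is a real number, since bounds such as [n `^ eps] are
   not integers. The neutral element 0 is harmless: correlations are
   nonnegative, and the range is nonempty when [0 <= d]. *)
Definition Cor_deg f (d : R) : R :=
  \big[Num.max/0]_(g : {ffun n.-tuple bool -> bool} |
      `[< exists p, (mpoly_degree p)%:R <= d /\ represents p g >]) Cor f g.

End Correlation.

Arguments Cor_deg {R n} f d.

Record gate := Gate {
  gate_op : bool -> bool -> bool;
  gate_l : nat;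
  gate_r : nat }.

(* Vertices are numbered in a topological order: [0, ..., n - 1] are the inputs
   and [n + i] is the gate at position [i] of [gates]. *)
Record circuit (n : nat) := Circuit {
  gates : seq gate;
  output : nat;
  gates_acyclic : forall i g, onth gates i = Some g ->
    (gate_l g < n + i)%N /\ (gate_r g < n + i)%N;
  output_lt : (output < n + size gates)%N }.

Section Circuits.
Variable n : nat.
Implicit Types (C : circuit n) (f : boolfun n).

Definition circuit_size C : nat := size (gates C).

Definition circuit_values C (x : n.-tuple bool) : seq bool :=
  foldl (fun vs g => rcons vs
           (gate_op g (nth false vs (gate_l g)) (nth false vs (gate_r g))))
        x (gates C).

Definition circuit_eval C (x : n.-tuple bool) : bool :=
  nth false (circuit_values C x) (output C).

Definition computes C f : Prop := circuit_eval C =1 f.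

(* Entry [v] is the length of a longest path from an input to vertex [v]. *)
Definition circuit_depths C : seq nat :=
  foldl (fun ds g => rcons ds
           (maxn (nth 0 ds (gate_l g)) (nth 0 ds (gate_r g))).+1)%N
        (nseq n 0%N) (gates C).

Definition circuit_depth C : nat := nth 0%N (circuit_depths C) (output C).

Definition vertex C := 'I_(n + circuit_size C).

Definition edge C (u v : vertex C) : Prop :=
  exists i g, [/\ onth (gates C) i = Some g, (v : nat) = (n + i)%N
                & (u : nat) = gate_l g \/ (u : nat) = gate_r g].

Definition series_parallel C : Prop :=
  exists l : vertex C -> nat,
    (forall u v, edge u v -> (l u < l v)%N) /\
    ~ (exists u v u' v', [/\ edge u v, edge u' v' &
         [/\ (l u < l u')%N, (l u' < l v)%N & (l v < l v')%N]]).

(* An infimum of natural numbers, hence a minimum; it is +oo only if no circuit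
   computes [f], which happens only for [n = 0] (constants are not sources). *)
Definition min_circuit_size (R : realType) f : \bar R :=
  ereal_inf [set ((circuit_size C)%:R)%:E | C in [set C | computes C f]].

End Circuits.

Definition ssp_superlinear (R : realType) (f : forall n, boolfun n) : Prop :=
  forall c : R, \forall n \near \oo,
    ~ exists C : circuit n, [/\ computes C (f n), series_parallel C
        & (circuit_size C)%:R <= c * n%:R].

Definition slog_superlinear (R : realType) (f : forall n, boolfun n) : Prop :=
  forall c : R, \forall n \near \oo,
    ~ exists C : circuit n, [/\ computes C (f n),
        (circuit_size C)%:R <= c * n%:R
      & (circuit_depth C)%:R <= c * log2 n%:R].

(* Main.v *)
(**
Guess the values of a few gates of a circuit for [f], each of which is, given the
previous guesses, a polynomial of degree at most [d] in the inputs. A leaf of the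
guessing tree is a set [S] cut out by such polynomials, its indicator function is
an average of signs of polynomials of degree at most [d], and if [f] has degree at
most [d] on [S] then [#|S| <= 2 ^ n * Cor(f, d)]. Hence a tree with [L] leaves
gives [1 <= L * Cor(f, d)].

(1) A guess of a gate [i] removes [i], the gates reading [i], and the gates that
feed only into [i]. If these are at least 4 gates then both guesses are cheap. A
sum with two readers and a gate among its inputs also removes that gate. A product
with two readers and a gate among its inputs removes 3 gates or 5, since one of its
two values determines both factors. If no gate of degree at most 12 can be removed
in this way, every gate has degree at most 6. So [L <= 2 ^ ((s + 4) / 3.9)].

(2) The label intervals of the edges are laminar, so every interval can be split at
a point over which no edge jumps. Remove the edges whose number of left turns, or
of right turns, in the resulting binary tree is [i] modulo [K]. A path over an
interval splits into paths over its two halves; as the last edge of a path to the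
right end has made no further left turn, and the first edge of a path from the left
end no further right turn, an induction on the distances of the two counters to [i]
bounds the length of the remaining paths in terms of [K]. A suitable [i] removes a
fraction [2 / K] of the edges.

(3), (4) Delete one digit of the depths written in base [B], and remove the edges
whose endpoints first differ in this digit.
*)

Require Import Defs.
From HB Require Import structures.
From mathcomp Require Import all_boot all_order all_algebra.
From mathcomp Require Import all_classical all_reals all_analysis.
From mathcomp Require Import -(notations) mpoly.
From mathcomp Require Import zify ring lra.

Set Implicit Arguments.
Unset Strict Implicit.
Unset Printing Implicit Defensive.

Import Order.TTheory GRing.Theory Num.Theory.

Local Open Scope ring_scope.

(** * Correlation with low-degree polynomials *)

Lemma boolop_anf (op : bool -> bool -> bool) : exists c0 c1 c2 c3, forall a b,
  op a b = (c0 (+) (a && c1)) (+) ((b && c2) (+) (a && b && c3)).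
Proof.
set c00 := op false false; set c10 := op true false.
set c01 := op false true; set c11 := op true true.
exists c00, (c10 (+) c00), (c01 (+) c00), (c11 (+) c10 (+) (c01 (+) c00)).
by move=> [] [] /=; rewrite -/c00 -/c10 -/c01 -/c11;
  case: c00; case: c10; case: c01; case: c11.
Qed.

Section LowDegree.
Variable n : nat.
Local Notation X := (n.-tuple bool).
Implicit Types (h : X -> bool) (d : nat) (S : pred X).

Definition low_degree d h := exists2 p, (mpoly_degree p <= d)%N & represents p h.

Lemma low_degreeW d d' h : (d <= d')%N -> low_degree d h -> low_degree d' h.
Proof. by move=> le_d [p le_p rp]; exists p => //; apply: leq_trans le_d. Qed.

Lemma low_degree_cst d b : low_degree d (fun=> b).
Proof.
exists (mpolyC n (b%:R : 'F_2)); last by move=> x; rewrite mevalC.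
by rewrite /mpoly_degree msizeC; case: (_ != _).
Qed.

Lemma low_degree_var (i : 'I_n) : low_degree 1 (fun x => tnth x i).
Proof.
exists (mpolyX _ (mnm1 i)); first by rewrite /mpoly_degree msizeX mdeg1.
by move=> x; rewrite mevalXU.
Qed.

Lemma low_degree_add d h1 h2 : low_degree d h1 -> low_degree d h2 ->
  low_degree d (fun x => h1 x (+) h2 x).
Proof.
move=> [p1 le1 r1] [p2 le2 r2]; exists (p1 + p2).
  move: le1 le2 (msizeD_le p1 p2); rewrite /mpoly_degree /maxn.
  by case: ifP; lia.
move=> x; rewrite mevalD r1 r2; case: (h1 x); case: (h2 x) => //=;
  by rewrite ?addr0 ?add0r //; apply/val_inj.
Qed.

Lemma low_degree_mul d1 d2 h1 h2 : low_degree d1 h1 -> low_degree d2 h2 ->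
  low_degree (d1 + d2) (fun x => h1 x && h2 x).
Proof.
move=> [p1 le1 r1] [p2 le2 r2]; exists (p1 * p2).
  move: le1 le2; rewrite /mpoly_degree.
  have [->|p1_neq0] := eqVneq p1 0; first by rewrite mul0r msize0.
  have [->|p2_neq0] := eqVneq p2 0; first by rewrite mulr0 msize0.
  by rewrite msizeM //; move: (mmeasure _ p1) (mmeasure _ p2); lia.
by move=> x; rewrite mevalM r1 r2 -natrM mulnb.
Qed.

Definition low_degree_on S d h :=
  exists2 h', low_degree d h' & forall x, S x -> h x = h' x.

Definition const_on S h := exists b, forall x, S x -> h x = b.

Lemma low_degree_onT S d h : low_degree d h -> low_degree_on S d h.
Proof. by exists h. Qed.

Lemma low_degree_onW S d d' h : (d <= d')%N ->
  low_degree_on S d h -> low_degree_on S d' h.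
Proof. by move=> le_d [h' lh' e]; exists h' => //; apply: low_degreeW lh'. Qed.

Lemma low_degree_on_cst S d h : const_on S h -> low_degree_on S d h.
Proof. by case=> b e; exists (fun=> b) => //; apply: low_degree_cst. Qed.

Lemma low_degree_on_op S d1 d2 (op : bool -> bool -> bool) h h1 h2 :
    low_degree_on S d1 h1 -> low_degree_on S d2 h2 ->
    (forall x, S x -> h x = op (h1 x) (h2 x)) ->
  low_degree_on S (d1 + d2) h.
Proof.
move=> [g1 l1 e1] [g2 l2 e2] eh.
have [c0 [c1 [c2 [c3 anf]]]] := boolop_anf op.
have mul_cst d g c : low_degree d g -> low_degree d (fun x => g x && c).
  by move=> lg; rewrite -[d]addn0; apply: low_degree_mul (low_degree_cst 0 c).
exists (fun x => (c0 (+) (g1 x && c1)) (+) ((g2 x && c2) (+) (g1 x && g2 x && c3))).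
  apply: low_degree_add; apply: low_degree_add; first exact: low_degree_cst.
  - by apply: low_degreeW (mul_cst _ _ c1 l1); rewrite leq_addr.
  - by apply: low_degreeW (mul_cst _ _ c2 l2); rewrite leq_addl.
  - exact/mul_cst/low_degree_mul.
by move=> x Sx; rewrite eh // anf e1 // e2.
Qed.

Inductive polyset d : pred X -> Prop :=
| polysetT : polyset d xpredT
| polysetI S S' h b of polyset d S & low_degree d h
    & (forall x, S' x = S x && (h x == b)) : polyset d S'.

Definition guess S h b : pred X := fun x => S x && (h x == b).

Lemma guess_sub S h b : {subset guess S h b <= S}.
Proof. by move=> x /andP[]. Qed.

Lemma guess_const S h b : const_on (guess S h b) h.
Proof. by exists b => x /andP[_ /eqP]. Qed.

Lemma polyset_guess d S h b :
  polyset d S -> low_degree_on S d h -> polyset d (guess S h b).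
Proof.
move=> pS [h' lh' e]; apply: (polysetI (b := b) pS lh') => x.
by rewrite /guess; case Sx: (S x) => //=; rewrite e.
Qed.

Lemma card_guess S h : #|S| = (#|guess S h true| + #|guess S h false|)%N.
Proof.
rewrite -(cardID (fun x => h x) S); congr (_ + _)%N; apply: eq_card => x;
  rewrite !inE /guess /in_mem /=; case: (S x) => //=; by case: (h x).
Qed.

Variables (R : realType) (f : boolfun n).

Definition correlation_bound d (M : R) := forall h, low_degree d h ->
  `|\sum_x (-1) ^+ (f x (+) h x)| <= M.

Lemma correlation_bound_ge0 d M : correlation_bound d M -> 0 <= M.
Proof. by move/(_ _ (low_degree_cst d false)); apply: le_trans. Qed.

(* The indicator function of [g x == b] is [(1 + (-1) ^+ b * (-1) ^+ g x) / 2]. *)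
Lemma polyset_sum d M S h : correlation_bound d M -> polyset d S ->
  low_degree d h -> `|\sum_(x | S x) (-1) ^+ (f x (+) h x)| <= M.
Proof.
move=> fM pS; elim: pS h => [h|{}S S' g b _ IH lg eS h lh]; first exact: fM.
have -> : \sum_(x | S' x) (-1) ^+ (f x (+) h x) =
   2^-1 * (\sum_(x | S x) (-1) ^+ (f x (+) h x)
    + (-1) ^+ b * \sum_(x | S x) (-1) ^+ (f x (+) (h x (+) g x))) :> R.
  rewrite (eq_bigl _ _ eS) big_mkcondr mulr_sumr -big_split /= mulr_sumr.
  apply: eq_bigr => x _; rewrite addbA !signr_addb.
  by case: (g x); case: (b) => //=; case: (f x); case: (h x) => /=; field.
rewrite normrM ger0_norm ?invr_ge0 // mulrC ler_pdivrMr // mulr_natr mulr2n.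
apply: le_trans (ler_normD _ _) _; rewrite normrM normr_sign mul1r.
by rewrite lerD ?IH //; apply: low_degree_add.
Qed.

Lemma card_polyset_le d M S : correlation_bound d M -> polyset d S ->
  low_degree_on S d f -> #|S|%:R <= M.
Proof.
move=> fM pS [h lh e]; have := polyset_sum fM pS lh.
rewrite (eq_bigr (fun=> 1)); last by move=> x Sx; rewrite e // addbb.
by rewrite sumr_const ger0_norm.
Qed.

Lemma sum_sign_Pr (g : boolfun n) : \sum_x (-1) ^+ (f x (+) g x) =
  2 ^+ n * (Pr R (fun x => f x == g x) - Pr R (fun x => f x != g x)).
Proof.
rewrite /Pr card_tuple card_bool natrX -mulrBl mulrCA divff ?expf_neq0 // mulr1.
rewrite (bigID (fun x => f x == g x)) /=.
rewrite (eq_bigr (fun=> 1)); last by move=> x /eqP ->; rewrite addbb.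
rewrite [X in _ + X](eq_bigr (fun=> -1)); last first.
  by move=> x; case: (f x); case: (g x).
by rewrite !sumr_const mulNrn; congr (_%:R - _%:R); apply: eq_card => x;
  rewrite !inE.
Qed.

Lemma correlation_bound_Cor_deg d (r : R) : d%:R <= r ->
  correlation_bound d (2 ^+ n * Cor_deg f r).
Proof.
move=> le_dr h [p le_p rp].
have [g hg] : exists g : {ffun X -> bool}, h = g.
  by exists (finfun h); apply/funext => x; rewrite ffunE.
rewrite {h}hg in rp *.
rewrite sum_sign_Pr normrM ger0_norm ?exprn_ge0 // ler_pM2l ?exprn_gt0 //.
have g_rep : `[< exists p, (mpoly_degree p)%:R <= r /\ represents p g >].
  by apply/asboolP; exists p; rewrite (le_trans _ le_dr) ?ler_nat.
by rewrite /Cor_deg (bigD1 g) //= le_max lexx.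
Qed.

End LowDegree.

(** * Gate elimination *)

Section Budget.
Variable R : realType.
Implicit Types t : R.

Definition budget t : R := 2 `^ (10 / 39 * (t + 4)).

Definition gate_cost : R := 2 `^ (- (10 / 39)).

Lemma budget_gt0 t : 0 < budget t.
Proof. exact: powR_gt0. Qed.

Lemma ler_budget t t' : t <= t' -> budget t <= budget t'.
Proof. by move=> le_tt'; rewrite ler_powR ?ler1n //; lra. Qed.

Lemma budget_ge1 t : - 4 <= t -> 1 <= budget t.
Proof. by move=> t_ge; rewrite -(powRr0 2) ler_powR ?ler1n //; lra. Qed.

Lemma budgetB t k : budget (t - k%:R) = budget t * gate_cost ^+ k.
Proof.
rewrite /gate_cost -powR_mulrn ?powR_ge0 // -powRrM /budget.
by rewrite -powRD ?pnatr_eq0 ?implybT //; congr (_ `^ _); field.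
Qed.

Lemma gate_cost_le : gate_cost <= 67 / 80.
Proof.
rewrite -(@ler_pXn2r _ 39) ?nnegrE ?powR_ge0 ?divr_ge0 //.
have -> : gate_cost ^+ 39 = (2 ^+ 10)^-1.
  rewrite -powR_mulrn ?powR_ge0 // -powRrM -powR_mulrn // -powRN.
  by congr (_ `^ _); field.
by lra.
Qed.

Lemma gate_costX_le k : gate_cost ^+ k <= (67 / 80) ^+ k.
Proof. by rewrite lerXn2r ?nnegrE ?powR_ge0 ?gate_cost_le ?divr_ge0. Qed.

Lemma budget_branch44 t : budget (t - 4%:R) + budget (t - 4%:R) <= budget t.
Proof.
rewrite !budgetB -mulrDr ler_piMr ?(ltW (budget_gt0 _)) //.
by have := gate_costX_le 4; lra.
Qed.

(* This is where 3.9 comes from: [gate_cost] is just below the root of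
   [u ^+ 3 + u ^+ 5 = 1]. *)
Lemma budget_branch35 t : budget (t - 3%:R) + budget (t - 5%:R) <= budget t.
Proof.
rewrite !budgetB -mulrDr ler_piMr ?(ltW (budget_gt0 _)) //.
by have := lerD (gate_costX_le 3) (gate_costX_le 5); lra.
Qed.

End Budget.

Section Subcircuit.
Variables (n N : nat) (v : 'I_N -> n.-tuple bool -> bool) (f : boolfun n).
Implicit Types (S : pred (n.-tuple bool)) (A D : {set 'I_N}) (i j k u : 'I_N).

Definition available A j := (j < n)%N || (j \in A).

(* Vertex [i] always carries the function [v i]: passing to a smaller set [S]
   only makes vertices drop out of [live] and the remaining ones be rewired. *)
Record subcircuit S := Subcircuit {
  live : {set 'I_N};
  live_op : 'I_N -> bool -> bool -> bool;
  wire1 : 'I_N -> 'I_N;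
  wire2 : 'I_N -> 'I_N;
  out : 'I_N;
  decode : bool -> bool;
  live_wires : forall i, i \in live ->
    [/\ (n <= i)%N, (wire1 i < i)%N, (wire2 i < i)%N,
        available live (wire1 i) & available live (wire2 i)];
  live_value : forall i x, i \in live -> S x ->
    v i x = live_op i (v (wire1 i) x) (v (wire2 i) x);
  out_available : available live out;
  out_value : forall x, S x -> f x = decode (v out x) }.

Section Pruning.
Variables (S : pred (n.-tuple bool)) (C : subcircuit S).

Definition reads i j := (wire1 C i == j) || (wire2 C i == j).

Lemma reads_wires i : reads i (wire1 C i) /\ reads i (wire2 C i).
Proof. by rewrite /reads !eqxx orbT. Qed.

Lemma reads_lt i j : i \in live C -> reads i j -> (j < i)%N.
Proof. by move=> /live_wires[_ ? ? _ _] /orP[] /eqP <-. Qed.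

Lemma reads_available i j : i \in live C -> reads i j -> available (live C) j.
Proof. by move=> /live_wires[_ _ _ ? ?] /orP[] /eqP <-. Qed.

Lemma live_value_from i j : i \in live C -> reads i j ->
  exists (op : bool -> bool -> bool) k, [/\ reads i k,
    forall k', reads i k' -> k' = j \/ k' = k &
    forall x, S x -> v i x = op (v j x) (v k x)].
Proof.
move=> iC /orP[] /eqP <-.
  exists (live_op C i), (wire2 C i); split=> [|k' /orP[]/eqP|x /(live_value iC)] //.
  - exact: (reads_wires i).2.
  - by left.
  - by right.
exists (fun a b => live_op C i b a), (wire1 C i).
split=> [|k' /orP[]/eqP|x /(live_value iC)] //.
- exact: (reads_wires i).1.
- by right.
- by left.
Qed.

Lemma available_inputs_gt0 i : available (live C) i -> (0 < n)%N.
Proof.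
have [m] := ubnP i; elim: m i => // m IHm i lt_im /orP[/(leq_ltn_trans _)->//|iC].
have ri := (reads_wires i).1; apply: IHm (reads_available iC ri).
exact: leq_trans (reads_lt iC ri) _.
Qed.

Variables (S' : pred (n.-tuple bool)) (D : {set 'I_N}).

Definition redundant i := const_on S' (v i) \/
  exists u (psi : bool -> bool), [/\ (u < i)%N, available (live C) u, u \notin D &
    forall x, S' x -> v i x = psi (v u x)].

Definition removed : {set 'I_N} :=
  [set i in live C | (i \in D) || `[< redundant i >]].

Definition prunable := out C \notin D /\ forall i j, i \in live C -> i \notin D ->
  j \in D -> reads i j -> redundant i.

Lemma redundant_removed i : i \in live C -> redundant i -> i \in removed.
Proof. by move=> iC ri; rewrite inE iC (asboolT ri) orbT. Qed.

Lemma reader_redundant i j : {subset S' <= S} -> const_on S' (v j) ->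
  i \in live C -> reads i j -> (forall k, k \in D -> ~~ reads i k) -> redundant i.
Proof.
move=> sS' [b vj] iC rij nD; have [op [k [rik _ vi]]] := live_value_from iC rij.
right; exists k, (op b); split=> [|||x Sx]; last by rewrite vi ?vj //; apply: sS'.
- exact: reads_lt rik.
- exact: reads_available rik.
- by apply/negP=> /nD; rewrite rik.
Qed.

Lemma redundant_subst i : available (live C) i -> i \notin D ->
  exists u (psi : bool -> bool), [/\ (u <= i)%N,
    available (live C :\: removed) u & forall x, S' x -> v i x = psi (v u x)].
Proof.
have [m] := ubnP i; elim: m i => // m IHm i lt_im iC iD.
have [[[b vi]|[u [psi [lt_ui uC uD vi]]]]|nri] := pselect (redundant i).
- exists (Ordinal (leq_ltn_trans (leq0n i) (ltn_ord i))), (fun=> b).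
  by split; rewrite // /available /= (available_inputs_gt0 iC).
- have [w [chi [le_wu wC vu]]] := IHm u (leq_trans lt_ui lt_im) uC uD.
  exists w, (psi \o chi); split=> // [|x Sx]; last by rewrite vi // vu.
  exact: leq_trans le_wu (ltnW lt_ui).
- exists i, id; split=> //; rewrite /available !inE (negPf iD) orFb.
  by case/orP: iC => [->//|->]; rewrite andbT (asboolF nri) orbT.
Qed.

Lemma prune : {subset S' <= S} -> prunable ->
  exists C' : subcircuit S', live C' = live C :\: removed.
Proof.
move=> sS' [oD readD].
have /choice[g gP] : forall i, exists t : 'I_N * (bool -> bool),
    available (live C) i -> i \notin D ->
    [/\ (t.1 <= i)%N, available (live C :\: removed) t.1 &
        forall x, S' x -> v i x = t.2 (v t.1 x)].
  move=> i; have [iC|niC] := boolP (available (live C) i); last by exists (i, id).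
  have [iD|niD] := boolP (i \in D); first by exists (i, id).
  by have [u [psi ?]] := redundant_subst iC niD; exists (u, psi).
have rewire i j : i \in live C :\: removed -> reads i j ->
    [/\ ((g j).1 < i)%N, available (live C :\: removed) (g j).1 &
        forall x, S' x -> v j x = (g j).2 (v (g j).1 x)].
  rewrite !inE negb_and => /andP[+ iC]; rewrite iC orFb negb_or.
  move=> /andP[iD /asboolP nri] rij.
  have [|le_u uC vj] := gP j (reads_available iC rij).
    by apply/negP=> jD; apply: nri (readD i j _ _ _ _).
  by split=> //; apply: leq_ltn_trans le_u (reads_lt iC rij).
have [_ oC vo] := gP _ (out_available C) oD.
unshelve eexists (@Subcircuit S' (live C :\: removed)
  (fun i a b => live_op C i ((g (wire1 C i)).2 a) ((g (wire2 C i)).2 b))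
  (fun i => (g (wire1 C i)).1) (fun i => (g (wire2 C i)).1)
  (g (out C)).1 (decode C \o (g (out C)).2) _ _ oC _) => //.
- move=> i iC; have [r1 r2] := reads_wires i.
  have [lt1 av1 _] := rewire i _ iC r1; have [lt2 av2 _] := rewire i _ iC r2.
  by split=> //; move: iC; rewrite inE => /andP[_ /live_wires[]].
- move=> i x iC Sx; have [r1 r2] := reads_wires i.
  have [_ _ <-//] := rewire i _ iC r1; have [_ _ <-//] := rewire i _ iC r2.
  by move: iC; rewrite inE => /andP[_ iC]; apply: live_value (sS' x Sx).
- by move=> x Sx /=; rewrite -vo // (out_value C) //; apply: sS'.
Qed.

End Pruning.

Lemma prunable0 S (C : subcircuit S) S' : prunable C S' finset.set0.
Proof. by split=> [|i j _ _]; rewrite inE. Qed.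

End Subcircuit.

Lemma boolop_cases (op : bool -> bool -> bool) :
  [\/ exists psi : bool -> bool, forall a b, op a b = psi a,
      exists psi : bool -> bool, forall a b, op a b = psi b,
      exists c, forall a b, op a b = a (+) b (+) c |
      exists c1 c2 c, forall a b, op a b = ((a (+) c1) && (b (+) c2)) (+) c].
Proof.
have [c0 [c1 [c2 [c3 anf]]]] := boolop_anf op; case: c3 anf => anf.
  apply: Or44; exists c2, c1, (c0 (+) (c1 && c2)) => a b; rewrite anf {anf}.
  by case: a; case: b; case: c0; case: c1; case: c2.
case: c1 anf => anf; last first.
  by apply: Or42; exists (fun b => c0 (+) (b && c2)) => a b; rewrite anf !andbF !addbF.
case: c2 anf => anf; last first.
  by apply: Or41; exists (fun a => c0 (+) a) => a b; rewrite anf !andbF andbT !addbF.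
apply: Or43; exists c0 => a b.
by rewrite anf !andbT andbF addbF -addbA addbC.
Qed.

Lemma uniq_ord_sorted N (s : seq 'I_N) : sorted ltn (map val s) -> uniq s.
Proof. by move/(sorted_uniq ltn_trans ltnn); rewrite (map_inj_uniq val_inj). Qed.

Section GateElimination.
Variables (R : realType) (n N : nat) (v : 'I_N -> n.-tuple bool -> bool).
Variables (f : boolfun n) (M : R).
Hypothesis fM : correlation_bound f 12 M.
Hypothesis v_input : forall i : 'I_N, (i < n)%N -> low_degree 1 (v i).

Definition within_budget (S : pred (n.-tuple bool)) (t : R) :=
  #|S|%:R <= budget t * M.

Lemma within_budgetW S t t' : t <= t' -> within_budget S t -> within_budget S t'.
Proof.
move=> le_tt' /le_trans; apply.
by rewrite ler_wpM2r ?ler_budget // (correlation_bound_ge0 fM).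
Qed.

Lemma within_budget_low_degree S t : - 4 <= t -> polyset 12 S ->
  low_degree_on S 12 f -> within_budget S t.
Proof.
move=> t_ge pS /(card_polyset_le fM pS) /le_trans; apply.
by rewrite ler_peMl ?budget_ge1 // (correlation_bound_ge0 fM).
Qed.

Section MinimalCounterexample.
Variables (S : pred (n.-tuple bool)) (C : subcircuit v f S).
Hypothesis S_poly : polyset 12 S.
Hypothesis smaller_within : forall S' (C' : subcircuit v f S'),
  (#|live C'| < #|live C|)%N -> polyset 12 S' -> within_budget S' #|live C'|%:R.
Hypothesis over_budget : ~ within_budget S #|live C|%:R.

Lemma prune_within S' (D : {set 'I_N}) m : polyset 12 S' -> {subset S' <= S} ->
    prunable C S' D -> (0 < m <= #|removed C S' D|)%N ->
  within_budget S' (#|live C|%:R - m%:R).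
Proof.
move=> pS' sS' pD /andP[m_gt0 le_m].
have [C' eC'] := prune sS' pD.
have sub : removed C S' D \subset live C.
  by apply/fintype.subsetP=> i; rewrite inE => /andP[].
have le_r := subset_leq_card sub.
have card_C' : #|live C'| = (#|live C| - #|removed C S' D|)%N.
  by rewrite eC' cardsD (finset.setIidPr sub).
apply: within_budgetW (smaller_within (C' := C') _ pS'); last first.
  by rewrite card_C'; lia.
by rewrite card_C' natrB // lerD2l lerN2 ler_nat.
Qed.

Lemma guess_prune_within i b (D : {set 'I_N}) m : low_degree_on S 12 (v i) ->
    prunable C (guess S (v i) b) D ->
    (0 < m <= #|removed C (guess S (v i) b) D|)%N ->
  within_budget (guess S (v i) b) (#|live C|%:R - m%:R).
Proof.
by move=> li; apply: prune_within (polyset_guess b S_poly li) (@guess_sub _ _ _ _).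
Qed.

Lemma unprunable (D : {set 'I_N}) i : prunable C S D -> i \in removed C S D -> False.
Proof.
move=> pD iD; apply: over_budget.
apply: within_budgetW (prune_within (m := 1) S_poly _ pD _) => //.
  by rewrite gerBl.
by rewrite (cardD1 i) iD.
Qed.

Lemma live_irredundant i : i \in live C -> ~ redundant C S finset.set0 i.
Proof.
move=> iC ri; apply: unprunable (prunable0 C S) (redundant_removed iC ri).
Qed.

Lemma live_not_unary i j (psi : bool -> bool) : i \in live C -> reads C i j ->
  ~ forall x, S x -> v i x = psi (v j x).
Proof.
move=> iC rij vi; apply: (live_irredundant iC); right; exists j, psi.
by split; rewrite ?inE ?(reads_lt iC rij) ?(reads_available iC rij).
Qed.

Lemma live_wires_neq i : i \in live C -> wire1 C i != wire2 C i.
Proof.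
move=> iC; apply/eqP=> w12; have [r1 _] := reads_wires C i.
apply: (live_not_unary iC r1 (psi := fun a => live_op C i a a)) => x Sx.
by rewrite (live_value iC Sx) -w12.
Qed.

Lemma live_read i : i \in live C -> i != out C ->
  exists2 j, j \in live C & reads C j i.
Proof.
move=> iC io; apply: contrapT => unread.
apply: (@unprunable [set i] i); last by rewrite !inE iC eqxx.
split=> [|k j kC _ /set1P-> rki]; first by rewrite inE eq_sym.
by case: unread; exists k.
Qed.

Lemma out_not_low_degree : ~ low_degree_on S 12 (v (out C)).
Proof.
move=> lo; apply: over_budget; apply: within_budget_low_degree => //.
  by apply: le_trans (ler0n _ _); lra.
have l0 : low_degree_on S 0 xpredT by apply: low_degree_on_cst; exists true.
exact: (low_degree_on_op (op := fun a _ => decode C a) lo l0 (out_value C)).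
Qed.

Lemma live_le_out i : i \in live C -> (i <= out C)%N.
Proof.
have [m] := ubnP (N - i); elim: m i => // m IHm i lt_m iC.
have [->//|io] := eqVneq i (out C); have [j jC rji] := live_read iC io.
have lt_ij := reads_lt jC rji; apply: leq_trans (ltnW lt_ij) (IHm j _ jC).
by have := ltn_ord j; lia.
Qed.

Definition fanout i := #|[set j in live C | reads C j i]|.

Lemma low_degree_fanout_gt0 i : i \in live C -> low_degree_on S 12 (v i) ->
  (0 < fanout i)%N.
Proof.
move=> iC li; have [|j jC rji] := live_read iC; last first.
  by apply/card_gt0P; exists j; rewrite inE jC.
by apply/eqP=> io; apply: out_not_low_degree; rewrite -io.
Qed.

Lemma fanout_gt1P i : (1 < fanout i)%N -> exists j1 j2 : 'I_N,
  [/\ j1 \in live C, j2 \in live C, reads C j1 i, reads C j2 i & (j1 < j2)%N].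
Proof.
case/card_gt1P=> j1 [j2 []]; rewrite !inE => /andP[C1 r1] /andP[C2 r2].
by rewrite -(inj_eq val_inj) neq_ltn => /orP[lt|lt]; [exists j1, j2 | exists j2, j1].
Qed.

Lemma branch44_contra i :
  (forall b, within_budget (guess S (v i) b) (#|live C|%:R - 4%:R)) -> False.
Proof.
move=> within4; apply: over_budget.
rewrite /within_budget (card_guess S (v i)) natrD.
apply: le_trans (lerD (within4 true) (within4 false)) _.
by rewrite -mulrDl ler_wpM2r ?(correlation_bound_ge0 fM) // budget_branch44.
Qed.

Lemma branch35_contra i b :
  within_budget (guess S (v i) b) (#|live C|%:R - 3%:R) ->
  within_budget (guess S (v i) (~~ b)) (#|live C|%:R - 5%:R) -> False.
Proof.
move=> within3 within5; apply: over_budget; rewrite /within_budget.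
have -> : #|S| = (#|guess S (v i) b| + #|guess S (v i) (~~ b)|)%N.
  by rewrite (card_guess S (v i)); case: b {within3 within5} => //; rewrite addnC.
rewrite natrD; apply: le_trans (lerD within3 within5) _.
by rewrite -mulrDl ler_wpM2r ?(correlation_bound_ge0 fM) // budget_branch35.
Qed.

Definition feeds_only (D : {set 'I_N}) i := forall j k,
  j \in D -> k \in live C -> reads C k j -> k \in D \/ k = i.

Lemma guess_feeders_within (D : {set 'I_N}) i b : i \in live C ->
    low_degree_on S 12 (v i) -> D \subset live C ->
    (forall j, j \in D -> (j < i)%N) -> feeds_only D i ->
  within_budget (guess S (v i) b) (#|live C|%:R - (#|D| + (fanout i).+1)%:R).
Proof.
move=> iC li /fintype.subsetP DC lt_Di Di.
have i_redundant : redundant C (guess S (v i) b) D i by left; apply: guess_const.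
have nDi (j : 'I_N) : (i <= j)%N -> j \notin D.
  by move=> le_ij; apply/negP=> /lt_Di; rewrite ltnNge le_ij.
apply: guess_prune_within => //.
  split=> [|k j kC kD jD]; first exact/nDi/live_le_out.
  by move=> /(Di _ _ jD kC)[kD'|->//]; rewrite kD' in kD.
pose readers := [set j in live C | reads C j i].
have i_readers : i \notin readers.
  by rewrite inE; apply/negP=> /andP[_ /(reads_lt iC)]; rewrite ltnn.
have disj : D :&: (i |: readers) = finset.set0.
  apply/finset.setP=> j; rewrite !inE; apply/negP=> /andP[jD].
  case/orP=> [/eqP ji|/andP[jC rji]]; move: jD; apply/negP/nDi; first by rewrite ji.
  exact/ltnW/(reads_lt jC rji).
have -> : (#|D| + (fanout i).+1)%N = #|(D :|: (i |: readers))|.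
  by rewrite cardsU disj cards0 subn0 cardsU1 i_readers.
apply/andP; split; first by apply/card_gt0P; exists i; rewrite !inE eqxx orbT.
apply: subset_leq_card; apply/fintype.subsetP=> j.
rewrite finset.in_setU in_setU1 => /or3P[jD|/eqP->|].
- by rewrite inE DC // jD.
- exact: redundant_removed.
rewrite inE => /andP[jC rji]; apply: redundant_removed => //.
have i_const := guess_const S (v i) b.
apply: (reader_redundant (@guess_sub _ S (v i) b) i_const jC rji) => k kD.
have lt_ij := reads_lt jC rji.
apply/negP=> /(Di _ _ kD jC)[/lt_Di|ji]; first by rewrite ltnNge ltnW.
by rewrite ji ltnn in lt_ij.
Qed.

Lemma card_feeders_fanout_le2 (D : {set 'I_N}) i : i \in live C ->
    low_degree_on S 12 (v i) -> D \subset live C ->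
    (forall j, j \in D -> (j < i)%N) -> feeds_only D i ->
  (#|D| + fanout i <= 2)%N.
Proof.
move=> iC li DC lt_Di Di; rewrite leqNgt; apply/negP=> gt2.
apply: (@branch44_contra i) => b.
apply: within_budgetW (guess_feeders_within b iC li DC lt_Di Di).
by rewrite lerD2l lerN2 ler_nat addnS.
Qed.

Lemma live_value_max_input i j : i \in live C -> j \in live C -> reads C i j ->
  exists (p q : 'I_N) (op : bool -> bool -> bool),
    [/\ p \in live C, reads C i p, reads C i q, (q < p)%N &
        forall x, S x -> v i x = op (v p x) (v q x)].
Proof.
move=> iC jC rij.
have [p rip pmax] : exists2 p, reads C i p & forall k, reads C i k -> (k <= p)%N.
  have [r1 r2] := reads_wires C i.
  have [le|le] := leqP (wire1 C i) (wire2 C i);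
    [exists (wire2 C i)|exists (wire1 C i)] => //;
    by move=> k /orP[] /eqP <- //; apply: ltnW.
have pC : p \in live C.
  have := reads_available iC rip; rewrite /available ltnNge.
  by have [/leq_trans-> //] := live_wires jC; apply: pmax.
have [op [q [riq inputs vi]]] := live_value_from iC rip.
exists p, q, op; split=> //; rewrite ltn_neqAle (pmax _ riq) andbT.
apply/negP=> /eqP/val_inj qp; have [r1 r2] := reads_wires C i.
have input_p k : reads C i k -> k = p by rewrite -qp => /inputs[]->.
by have := live_wires_neq iC; rewrite (input_p _ r1) (input_p _ r2) eqxx.
Qed.

Lemma const_reader_removed S' k j : {subset S' <= S} -> const_on S' (v j) ->
  k \in live C -> reads C k j -> k \in removed C S' finset.set0.
Proof.
move=> sS' cj kC rkj; apply: redundant_removed => //.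
by apply: (reader_redundant sS' cj kC rkj) => j'; rewrite inE.
Qed.

Lemma sum_fanout_le1 i (p q : 'I_N) c : i \in live C ->
    low_degree_on S 12 (v i) -> p \in live C -> reads C i p -> reads C i q ->
    (q < p)%N -> (forall x, S x -> v i x = v p x (+) v q x (+) c) ->
  (fanout i <= 1)%N.
Proof.
move=> iC li pC rip riq lt_qp vi; rewrite leqNgt; apply/negP.
case/fanout_gt1P=> j1 [j2 [C1 C2 r1 r2 lt_12]].
apply: (@branch44_contra i) => b; have [d vd] := guess_const S (v i) b.
apply: guess_prune_within li (prunable0 C _) _.
apply/card_geqP; exists [:: p; i; j1; j2]; split=> //.
  by apply: uniq_ord_sorted; rewrite /= lt_12 (reads_lt iC rip) (reads_lt C1 r1).
have [sG ci] := (@guess_sub _ S (v i) b, guess_const S (v i) b).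
move=> j; rewrite !in_cons in_nil orbF => /or4P[] /eqP->.
- apply: redundant_removed => //; right.
  exists q, (fun a => a (+) d (+) c); split; rewrite ?inE ?(reads_available iC riq) //.
  move=> x Gx; have Sx : S x := sG x Gx; rewrite -(vd x Gx) vi //.
  by case: (v p x); case: (v q x); case: (c).
- by apply: redundant_removed => //; left.
- exact: const_reader_removed sG ci C1 r1.
- exact: const_reader_removed sG ci C2 r2.
Qed.

Lemma const_two_inputs (G : pred (n.-tuple bool)) k (i j : 'I_N) :
    {subset G <= S} -> k \in live C -> reads C k i -> reads C k j -> i != j ->
    const_on G (v i) -> const_on G (v j) -> const_on G (v k).
Proof.
move=> sG kC rki rkj ij [bi vi] [bj vj].
have [op [j' [_ inputs vk]]] := live_value_from kC rki.
have j'j : j' = j by case: (inputs _ rkj) => // ji; rewrite ji eqxx in ij.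
rewrite {}j'j in vk.
by exists (op bi bj) => x Gx; rewrite vk ?vi ?vj //; apply: sG.
Qed.

Lemma const_live_read (G : pred (n.-tuple bool)) k : {subset G <= S} ->
    ~ const_on G (v (out C)) -> k \in live C -> const_on G (v k) ->
  exists w : 'I_N, [/\ w \in removed C G finset.set0, w \in live C, reads C w k
    & (k < w)%N].
Proof.
move=> sG nco kC ck; have [ko|/(live_read kC)[w wC rwk]] := eqVneq k (out C).
  by rewrite ko in ck.
exists w; split=> //; last exact: reads_lt rwk.
exact: const_reader_removed sG ck wC rwk.
Qed.

(* If [y] is [j1] or [j2] then it is constant on [G], which makes its own
   readers redundant: the last of the redundant gates is not constant. *)
Lemma card_removed_ge5 (G : pred (n.-tuple bool)) (i p y j1 j2 : 'I_N) :
    {subset G <= S} -> const_on G (v p) -> const_on G (v i) ->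
    ~ const_on G (v (out C)) -> i \in live C -> p \in live C -> reads C i p ->
    y \in live C -> reads C y p -> y != i -> j1 \in live C -> j2 \in live C ->
    reads C j1 i -> reads C j2 i -> (j1 < j2)%N ->
  (4 < #|removed C G finset.set0|)%N.
Proof.
move=> sG cp ci nco iC pC rip yC ryp yi C1 C2 r1 r2 lt_12.
have [lt_pi lt_i1] := (reads_lt iC rip, reads_lt C1 r1).
rewrite ltnNge; apply/negP=> le4; pose s := [:: p; i; j1; j2].
have uniq_s : uniq s by apply: uniq_ord_sorted; rewrite /= lt_pi lt_i1 lt_12.
have s_removed : {subset s <= removed C G finset.set0}.
  move=> k; rewrite !in_cons in_nil orbF => /or4P[] /eqP->.
  - by apply: redundant_removed => //; left.
  - by apply: redundant_removed => //; left.
  - exact: const_reader_removed sG ci C1 r1.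
  - exact: const_reader_removed sG ci C2 r2.
have removed_s k : k \in removed C G finset.set0 -> k \in s.
  move=> kr; apply/negPn/negP=> ks; move: le4; rewrite leqNgt => /negP; apply.
  apply/card_geqP; exists (k :: s); rewrite [uniq _]/= ks; split=> // j.
  by rewrite in_cons => /predU1P[->|/s_removed].
have removed_le k : k \in removed C G finset.set0 -> (k <= j1)%N \/ k = j2.
  move/removed_s; rewrite !in_cons in_nil orbF => /or4P[] /eqP->.
  - by left; rewrite ltnW // (ltn_trans lt_pi).
  - by left; apply: ltnW.
  - by left.
  - by right.
have nc2 : ~ const_on G (v j2).
  move=> c2; have [w [/removed_le w_le wC rw lt_w]] := const_live_read sG nco C2 c2.
  have [le_w1|w2] := w_le.
    by have := leq_trans lt_w le_w1; rewrite ltnNge ltnW.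
  by rewrite w2 ltnn in lt_w.
have y1 : y = j1.
  have := removed_s y (const_reader_removed sG cp yC ryp).
  have lt_py := reads_lt yC ryp; rewrite !in_cons in_nil (negPf yi) orbF.
  case/or4P=> [/eqP yp|//|/eqP//|/eqP y2]; first by rewrite yp ltnn in lt_py.
  case: nc2; apply: (const_two_inputs sG C2 _ r2 _ cp ci); first by rewrite -y2.
  by rewrite -(inj_eq val_inj) ltn_eqF.
rewrite y1 {y yC yi y1} in ryp.
have c1 : const_on G (v j1).
  by apply: (const_two_inputs sG C1 ryp r1 _ cp ci); rewrite -(inj_eq val_inj) ltn_eqF.
have [w [w_removed wC rw lt_w]] := const_live_read sG nco C1 c1.
have w2 : w = j2 by have [|//] := removed_le w w_removed; rewrite leqNgt lt_w.
case: nc2; apply: (const_two_inputs sG C2 _ r2 _ c1 ci); first by rewrite -w2.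
by rewrite -(inj_eq val_inj) gtn_eqF.
Qed.

Lemma product_fanout_le1 i (p q : 'I_N) c1 c2 c : i \in live C ->
    low_degree_on S 12 (v i) -> p \in live C -> reads C i p ->
    (forall x, S x -> v i x = ((v p x (+) c1) && (v q x (+) c2)) (+) c) ->
  (fanout i <= 1)%N.
Proof.
move=> iC li pC rip vi; rewrite leqNgt; apply/negP=> gt1.
have [feeds|] := pselect (feeds_only [set p] i).
  suff : (#|[set p]| + fanout i <= 2)%N by rewrite cards1 add1n ltnNge gt1.
  apply: card_feeders_fanout_le2 => //; first by rewrite finset.sub1set.
  by move=> _ /set1P->; apply: reads_lt rip.
case/existsNP=> p' /existsNP[y] /not_implyP[/set1P->] /not_implyP[yC].
case/not_implyP=> ryp /not_orP[_ /eqP yi].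
have [j1 [j2 [C1 C2 r1 r2 lt_12]]] := fanout_gt1P gt1.
apply: (@branch35_contra i c).
  have := @guess_feeders_within finset.set0 i c iC li.
  rewrite cards0 add0n => within; apply: within_budgetW (within _ _ _).
  - by rewrite lerD2l lerN2 ler_nat.
  - exact: finset.sub0set.
  - by move=> j; rewrite inE.
  - by move=> j k; rewrite inE.
set G := guess S (v i) (~~ c).
have cp : const_on G (v p).
  exists (~~ c1) => x /andP[Sx]; rewrite vi //.
  by case: (v p x) (c1) (c) (_ (+) c2) => [] [] [] [].
have [co|nco] := pselect (const_on G (v (out C))).
  apply: within_budget_low_degree (polyset_guess _ S_poly li) _.
    have : (1 : R) <= #|live C|%:R by rewrite ler1n; apply/card_gt0P; exists i.
    by lra.
  apply: low_degree_on_cst; have [b vo] := co; exists (decode C b) => x Gx.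
  by rewrite (out_value C) ?vo //; apply: guess_sub Gx.
apply: guess_prune_within li (prunable0 C _) _.
apply: (@card_removed_ge5 G i p y j1 j2) => //; first exact: guess_sub.
exact: guess_const.
Qed.

Lemma branching_gate_inputs i j : i \in live C -> low_degree_on S 12 (v i) ->
  (1 < fanout i)%N -> reads C i j -> (j < n)%N.
Proof.
move=> iC li gt1 rij; have [//|jC] := orP (reads_available iC rij).
have [p [q [op [pC rip riq lt_qp vi]]]] := live_value_max_input iC jC rij.
case: (boolop_cases op) => [[psi opE]|[psi opE]|[c opE]|[c1 [c2 [c opE]]]].
- by case: (live_not_unary iC rip (psi := psi)) => x /vi; rewrite opE.
- by case: (live_not_unary iC riq (psi := psi)) => x /vi; rewrite opE.
- move: gt1; rewrite ltnNge (@sum_fanout_le1 i p q c) // => x Sx.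
  by rewrite vi ?opE.
move: gt1; rewrite ltnNge (@product_fanout_le1 i p q c1 c2 c) // => x Sx.
by rewrite vi ?opE.
Qed.

Definition shared j := (j \in live C) ==> (1 < fanout j)%N.

Definition gate_degree_bounds i :=
  [/\ low_degree_on S 6 (v i), shared i -> low_degree_on S 2 (v i) &
      (forall j, reads C i j -> shared j) -> low_degree_on S 4 (v i)].

Lemma unshared_feeds_only i j : i \in live C -> reads C i j -> ~~ shared j ->
  j \in live C /\ feeds_only [set j] i.
Proof.
move=> iC rij; rewrite negb_imply -leqNgt => /andP[jC /card_le1_eqP readers].
split=> // _ k /set1P-> kC rkj; right.
by apply: readers; rewrite inE ?kC ?iC.
Qed.

Lemma feeds_only_pair i k (a b : 'I_N) : feeds_only [set a] i ->
  feeds_only [set b] k -> k \in [set a; i] -> feeds_only [set a; b] i.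
Proof.
move=> feeds_a feeds_b /set2P k_ai _ w /set2P[]-> wC rw.
  have [/set1P->|->] := feeds_a _ _ (finset.set11 a) wC rw; last by right.
  by left; rewrite !inE eqxx.
have [/set1P->|->] := feeds_b _ _ (finset.set11 b) wC rw.
  by left; rewrite !inE eqxx orbT.
by case: k_ai => ->; [left; rewrite !inE eqxx | right].
Qed.

Lemma unshared_input_degrees i a b : i \in live C -> low_degree_on S 12 (v i) ->
    reads C i a -> reads C i b -> a != b -> ~~ shared a ->
    gate_degree_bounds a -> gate_degree_bounds b ->
  low_degree_on S 4 (v a) /\ low_degree_on S 2 (v b).
Proof.
move=> iC li ria rib ab nsa [_ _ deg_a] [_ deg_b _].
have [aC feeds_a] := unshared_feeds_only iC ria nsa.
have no_pair c : c \in live C -> c != a -> (c < i)%N -> ~ feeds_only [set a; c] i.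
  move=> cC ca lt_ci feeds; have := low_degree_fanout_gt0 iC li.
  suff : (#|[set a; c]| + fanout i <= 2)%N.
    by rewrite cards2 eq_sym ca (leq_add2l 2 _ 0) leqn0 => /eqP->.
  apply: card_feeders_fanout_le2 => //.
    by apply/fintype.subsetP=> k /set2P[] ->.
  by move=> k /set2P[] -> //; apply: reads_lt ria.
split.
- apply: deg_a => c rac; apply/negPn/negP=> nsc.
  have [cC feeds_c] := unshared_feeds_only aC rac nsc.
  have lt_ca := reads_lt aC rac.
  apply: (no_pair c) => //.
  + by rewrite -(inj_eq val_inj) ltn_eqF.
  + exact: ltn_trans lt_ca (reads_lt iC ria).
  + by apply: feeds_only_pair feeds_a feeds_c _; rewrite !inE eqxx.
- apply: deg_b; apply/negPn/negP=> nsb.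
  have [bC feeds_b] := unshared_feeds_only iC rib nsb.
  apply: (no_pair b) => //; [by rewrite eq_sym | exact: reads_lt rib |].
  by apply: feeds_only_pair feeds_a feeds_b _; rewrite !inE eqxx orbT.
Qed.

Lemma gate_degree_boundsP i : available n (live C) i -> gate_degree_bounds i.
Proof.
have [m] := ubnP i; elim: m i => // m IHm i lt_im /orP[lt_in|iC].
  have l1 := low_degree_onT S (v_input lt_in).
  by split=> [|_|_]; apply: low_degree_onW l1.
have input_bounds j : reads C i j -> gate_degree_bounds j.
  move=> rij; apply: IHm (reads_available iC rij).
  exact: leq_trans (reads_lt iC rij) lt_im.
have [r1 r2] := reads_wires C i.
have deg_op d1 d2 : low_degree_on S d1 (v (wire1 C i)) ->
    low_degree_on S d2 (v (wire2 C i)) -> low_degree_on S (d1 + d2) (v i).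
  by move=> l1 l2; apply: low_degree_on_op l1 l2 (fun x => live_value iC).
have [[deg1 sh1 _] [deg2 sh2 _]] := (input_bounds _ r1, input_bounds _ r2).
have li := deg_op _ _ deg1 deg2.
have w12 := live_wires_neq iC.
have deg4 : (forall j, reads C i j -> shared j) -> low_degree_on S 4 (v i).
  by move=> sh; apply: deg_op (sh1 (sh _ r1)) (sh2 (sh _ r2)).
split=> //.
- have [s1|ns1] := boolP (shared (wire1 C i)); last first.
    have [l4 l2] := unshared_input_degrees iC li r1 r2 w12 ns1
      (input_bounds _ r1) (input_bounds _ r2).
    exact: deg_op l4 l2.
  have [s2|ns2] := boolP (shared (wire2 C i)); last first.
    rewrite eq_sym in w12.
    have [l4 l2] := unshared_input_degrees iC li r2 r1 w12 ns2
      (input_bounds _ r2) (input_bounds _ r1).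
    exact: deg_op l2 l4.
  by apply: low_degree_onW (deg4 _) => // j /orP[] /eqP <-.
- rewrite /shared iC => gt1.
  have input_deg1 j : reads C i j -> low_degree_on S 1 (v j).
    by move=> rij; apply/low_degree_onT/v_input/(branching_gate_inputs iC li gt1 rij).
  exact: deg_op (input_deg1 _ r1) (input_deg1 _ r2).
Qed.

Lemma no_minimal_counterexample : False.
Proof.
have [deg6 _ _] := gate_degree_boundsP (out_available C).
by apply: out_not_low_degree; apply: low_degree_onW deg6.
Qed.

End MinimalCounterexample.

Lemma card_subcircuit_le S (C : subcircuit v f S) : polyset 12 S ->
  within_budget S #|live C|%:R.
Proof.
have [m] := ubnP #|live C|; elim: m S C => // m IHm S C lt_m pS.
apply: contrapT => over; apply: (no_minimal_counterexample pS _ over) => S' C' lt_C'.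
by apply: IHm; apply: leq_trans lt_C' _.
Qed.

End GateElimination.

(** * Depth reduction *)

Section DepthReduction.
Local Open Scope nat_scope.

(* Deleting any one of the [K] classes of edges leaves a graph on [{0, ..., c}] all
   of whose paths have length at most [T], as certified by the rank function. *)
Definition depth_reducible (K w T c : nat) (e : rel nat) :=
  exists cls : nat -> rel nat, (forall p q, \sum_(i < K) cls i p q <= w) /\
    forall i, i < K -> exists rho : nat -> nat,
      (forall q, q <= c -> rho q <= T) /\
      forall p q, q <= c -> e p q -> cls i p q || (rho p < rho q).

Lemma sum_exclusive_le1 K (P : nat -> bool) :
  (forall i j, i < j -> P i -> ~~ P j) -> \sum_(i < K) P i <= 1.
Proof.
move=> excl; have -> : \sum_(i < K) P i = #|[pred i : 'I_K | P i]|.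
  rewrite -sum1_card [RHS]big_mkcond; apply: eq_bigr => i _.
  by rewrite inE; case: (P i).
apply/card_le1_eqP => i j; rewrite !inE => Pi Pj; apply: val_inj.
by have [/excl|/excl|//] := ltngtP i j; rewrite Pi Pj => /(_ isT).
Qed.

Lemma longest_path_rank (e : rel nat) c T :
    (forall p q, e p q -> p < q) ->
    (forall p s, path e p s -> last p s <= c -> size s <= T) ->
  exists rho : nat -> nat, (forall q, q <= c -> rho q <= T) /\
    forall p q, q <= c -> e p q -> rho p < rho q.
Proof.
move=> e_lt bound.
pose ends q m := `[< exists p s, [/\ path e p s, last p s = q & size s = m] >].
have /choice[rho rhoP] : forall q, exists m, q <= c ->
    ends q m /\ forall m', ends q m' -> m' <= m.
  move=> q; have [le_qc|_] := boolP (q <= c); last by exists 0.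
  have ex : exists m, ends q m by exists 0; apply/asboolP; exists q, [::].
  have le_T m : ends q m -> m <= T.
    by case/asboolP=> p [s [ps qs <-]]; apply: bound ps _; rewrite qs.
  by exists (ex_maxn ex le_T); case: ex_maxnP.
exists rho; split=> [q le_qc|p q le_qc epq].
  have [/asboolP[p [s [ps qs <-]]] _] := rhoP q le_qc.
  by apply: bound ps _; rewrite qs.
have [/asboolP[p' [s [ps p's sz]]] _] := rhoP p (ltnW (leq_trans (e_lt _ _ epq) le_qc)).
have [_ rho_max] := rhoP q le_qc; apply: rho_max; apply/asboolP.
by exists p', (rcons s q); rewrite rcons_path ps last_rcons size_rcons sz p's epq.
Qed.

Section IncreasingPaths.
Variable e : rel nat.
Hypothesis e_lt : forall p q, e p q -> p < q.

Lemma path_bounds p s : path e p s -> all (fun x => p <= x <= last p s) (p :: s).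
Proof.
elim: s p => [|q s IHs] p /=; first by rewrite leqnn.
case/andP=> /e_lt lt_pq /IHs /= /andP[/andP[_ le_q]].
rewrite leqnn (leq_trans (ltnW lt_pq)) //= (ltnW lt_pq) le_q /=.
by apply: sub_all => x /andP[le_qx ->]; rewrite (leq_trans (ltnW lt_pq)).
Qed.

Lemma path_le_last p s : path e p s -> p <= last p s.
Proof. by move/path_bounds=> /andP[/andP[]]. Qed.

Lemma path_nil p s : path e p s -> last p s <= p -> s = [::].
Proof.
by case: s => //= q s /andP[/e_lt lt_pq /path_le_last le_q]; lia.
Qed.

Lemma sub_path_in (e' : rel nat) a c p s :
    (forall p q, a <= p -> q <= c -> e p q -> e' p q) ->
  a <= p -> last p s <= c -> path e p s -> path e' p s.
Proof.
move=> sub le_ap le_c eps.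
apply: (sub_in_path (P := fun x => a <= x <= c) _ _ eps).
  by move=> x y /andP[le_ax _] /andP[_ le_yc]; apply: sub.
by apply: sub_all (path_bounds eps) => x /andP[le_px le_xl]; lia.
Qed.

Definition separates a b c :=
  forall p q, e p q -> a <= p < b -> b < q <= c -> p = a /\ q = c.

Lemma path_separated a b c p s : separates a b c -> path e p s ->
    a <= p <= b -> b <= last p s <= c ->
  p = a /\ s = [:: c] \/ exists s1 s2, s = s1 ++ s2 /\ last p s1 = b.
Proof.
move=> sep; elim: s p => [|q s IHs] p /= eps le_apb le_bqc.
  by right; exists [::], [::]; split=> //=; lia.
case/andP: eps => epq eqs; have lt_pq := e_lt epq; have le_ql := path_le_last eqs.
have [pb|ne_pb] := eqVneq p b; first by right; exists [::], (q :: s).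
have [le_qb|lt_bq] := leqP q b.
  have [||[qa _]|[s1 [s2 [-> s1b]]]] := IHs q eqs => //; try lia.
  by right; exists (q :: s1), s2.
have [pa qc] : p = a /\ q = c by apply: sep epq _ _; lia.
have -> : s = [::] by apply: path_nil eqs _; lia.
by left; rewrite qc.
Qed.

End IncreasingPaths.

Definition noncrossing (e : rel nat) := forall p q p' q', e p q -> e p' q' ->
  ~~ [&& p < p', p' < q & q < q'].

Section Noncrossing.
Variable e : rel nat.
Hypothesis e_lt : forall p q, e p q -> p < q.
Hypothesis e_noncrossing : noncrossing e.

(* The far end of the longest edge from [a] that stays below [c] is a separator. *)
Lemma noncrossing_separator a c : a.+1 < c ->
  exists2 b, a < b < c & separates e a b c.
Proof.
move=> lt_ac; pose P b := (a < b < c) && (e a b || (b == a.+1)).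
have exP : exists b, P b by exists a.+1; rewrite /P leqnn lt_ac eqxx orbT.
have ubP b : P b -> b <= c by move=> /andP[/andP[_ /ltnW]].
case: (ex_maxnP exP ubP) => b /andP[b_in Pb] b_max.
exists b => // p q epq le_apb lt_bqc.
have [pa|ne_pa] := eqVneq p a.
  split=> //; apply/eqP; rewrite eqn_leq; case/andP: lt_bqc => lt_bq ->.
  rewrite leqNgt; apply/negP=> lt_qc; have := b_max q; rewrite /P -pa epq lt_qc; lia.
by case/orP: Pb => [eab|/eqP b1]; [have := e_noncrossing eab epq; lia | lia].
Qed.

Inductive dissection := Undivided | Divided of nat & dissection & dissection.

Fixpoint dissects a c t : Prop :=
  if t is Divided b t1 t2 then
    [/\ a < b < c, separates e a b c, dissects a b t1 & dissects b c t2]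
  else c <= a.+1.

Lemma noncrossing_dissection a c : exists t, dissects a c t.
Proof.
have [m] := ubnP (c - a); elim: m a c => // m IHm a c lt_m.
have [le_ca|lt_ac] := leqP c a.+1; first by exists Undivided.
have [b b_in sep] := noncrossing_separator lt_ac.
have [|t1 d1] := IHm a b; first by lia.
have [|t2 d2] := IHm b c; first by lia.
by exists (Divided b t1 t2).
Qed.

(* The numbers of left and of right turns on the way down from [[a, c]] to the
   smallest interval of the dissection that contains [[p, q]]. *)
Fixpoint turns t a c p q : nat * nat :=
  if t is Divided b t1 t2 then
    if (p == a) && (q == c) then (0, 0)
    else if q <= b then let lr := turns t1 a b p q in (lr.1.+1, lr.2)
    else let lr := turns t2 b c p q in (lr.1, lr.2.+1)
  else (0, 0).

Variables (K i : nat).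
Hypothesis lt_iK : i < K.

Definition kept l r t a c : rel nat := fun p q =>
  [&& e p q, (l + (turns t a c p q).1) %% K != i
           & (r + (turns t a c p q).2) %% K != i].

Lemma kept_lt l r t a c p q : kept l r t a c p q -> p < q.
Proof. by case/and3P=> /e_lt. Qed.

Lemma kept_left l r t1 t2 a b c p q : b < c -> q <= b ->
  kept l r (Divided b t1 t2) a c p q -> kept l.+1 r t1 a b p q.
Proof.
move=> lt_bc le_qb; rewrite /kept /= ifN ?le_qb /= ?addSnnS //.
by rewrite negb_and orbC ltn_eqF // (leq_ltn_trans le_qb).
Qed.

Lemma kept_right l r t1 t2 a b c p q : a < b -> b <= p ->
  kept l r (Divided b t1 t2) a c p q -> kept l r.+1 t2 b c p q.
Proof.
move=> lt_ab le_bp kpq; have lt_pq := kept_lt kpq; move: kpq.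
rewrite /kept /= ifN ?[q <= b]leqNgt ?(leq_ltn_trans le_bp) //= ?addSnnS //.
by rewrite negb_and gtn_eqF // (leq_trans lt_ab).
Qed.

Lemma kept_root l r t a c : kept l r t a c a c -> l %% K != i /\ r %% K != i.
Proof. by case: t => [|b t1 t2] /and3P[_] /=; rewrite ?eqxx /= !addn0. Qed.

Lemma kept_path_undivided l r a c p s : c <= a.+1 -> a <= p -> last p s <= c ->
  path (kept l r Undivided a c) p s ->
  s = [::] \/ [/\ p = a, s = [:: c] & kept l r Undivided a c a c].
Proof.
case: s => [|q s] /= le_ca le_ap le_c; first by left.
case/andP=> kpq kqs; right.
have lt_pq := kept_lt kpq; have le_ql := path_le_last (@kept_lt _ _ _ _ _) kqs.
have [pa qc] : p = a /\ q = c by lia.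
rewrite pa qc in kpq kqs le_c *.
by rewrite (path_nil (@kept_lt _ _ _ _ _) kqs).
Qed.

Lemma kept_path_divided l r b t1 t2 a c p s :
    dissects a c (Divided b t1 t2) -> a <= p -> last p s <= c ->
    path (kept l r (Divided b t1 t2) a c) p s ->
  [\/ last p s <= b /\ path (kept l.+1 r t1 a b) p s,
      b <= p /\ path (kept l r.+1 t2 b c) p s,
      [/\ p = a, s = [:: c] & kept l r (Divided b t1 t2) a c a c] |
      exists s1 s2, [/\ s = s1 ++ s2, last p s1 = b,
        path (kept l.+1 r t1 a b) p s1 & path (kept l r.+1 t2 b c) b s2]].
Proof.
case=> /andP[lt_ab lt_bc] sep _ _ le_ap le_c ks.
have lt_kept := @kept_lt l r (Divided b t1 t2) a c.
have goleft p' s' : a <= p' -> last p' s' <= b ->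
    path (kept l r (Divided b t1 t2) a c) p' s' -> path (kept l.+1 r t1 a b) p' s'.
  by apply: (sub_path_in lt_kept) => x y _; apply: kept_left.
have goright p' s' : b <= p' -> last p' s' <= c ->
    path (kept l r (Divided b t1 t2) a c) p' s' -> path (kept l r.+1 t2 b c) p' s'.
  by apply: (sub_path_in lt_kept) => x y le_bx _; apply: kept_right.
have [le_b|lt_b] := leqP (last p s) b; first by apply: Or41; split=> //; apply: goleft.
have [le_p|lt_p] := leqP b p; first by apply: Or42; split=> //; apply: goright.
have kept_sep : separates (kept l r (Divided b t1 t2) a c) a b c.
  by move=> x y /and3P[exy _ _]; apply: sep.
have [||[pa sc]|[s1 [s2 [ss s1b]]]] := path_separated lt_kept kept_sep ks; try lia.
  by apply: Or43; split=> //; move: ks; rewrite pa sc /= andbT.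
move: ks lt_b le_c; rewrite ss cat_path last_cat s1b => /andP[ks1 ks2] _ le_c.
by apply: Or44; exists s1, s2; split=> //; [apply: goleft; rewrite ?s1b | apply: goright].
Qed.

Lemma crossing_absent t l r a c s : dissects a c t -> a < c ->
    l %% K = i \/ r %% K = i ->
  path (kept l r t a c) a s -> last a s <> c.
Proof.
elim: t l r a c s => [|b t1 IH1 t2 IH2] l r a c s dt lt_ac lr ks sc.
- case: (kept_path_undivided dt (leqnn a) (eq_leq sc) ks) => [s0|[_ _ /kept_root[]]].
    by rewrite -sc s0 ltnn in lt_ac.
  by case: lr => ->; rewrite eqxx.
- have [/andP[lt_ab lt_bc] _ d1 d2] := dt.
  case: (kept_path_divided dt (leqnn a) (eq_leq sc) ks)
      => [[le_b _]|[le_ba _]|[_ _ /kept_root[]]|[s1 [s2 [ss s1b ks1 ks2]]]].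
  + by rewrite sc leqNgt lt_bc in le_b.
  + by rewrite leqNgt lt_ab in le_ba.
  + by case: lr => ->; rewrite eqxx.
  + rewrite ss last_cat s1b in sc.
    case: lr => lr; first exact: IH2 d2 lt_bc (or_introl lr) ks2 sc.
    exact: IH1 d1 lt_ab (or_intror lr) ks1 s1b.
Qed.

Lemma size_crossing_exp t l r dl dr a c s : dissects a c t ->
    (l + dl) %% K = i -> (r + dr) %% K = i ->
    path (kept l r t a c) a s -> last a s = c ->
  size s <= 2 ^ (dl + dr).
Proof.
elim: t l r dl dr a c s => [|b t1 IH1 t2 IH2] l r dl dr a c s dt l_dl r_dr ks sc.
  case: (kept_path_undivided dt (leqnn a) (eq_leq sc) ks) => [->|[_ -> _]] //=.
  by rewrite expn_gt0.
have [/andP[lt_ab lt_bc] _ d1 d2] := dt.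
case: (kept_path_divided dt (leqnn a) (eq_leq sc) ks)
    => [[le_b _]|[le_ba _]|[_ -> _]|[s1 [s2 [ss s1b ks1 ks2]]]].
- by rewrite sc leqNgt lt_bc in le_b.
- by rewrite leqNgt lt_ab in le_ba.
- by rewrite expn_gt0.
rewrite ss last_cat s1b in sc.
case: dl l_dl => [|dl] l_dl.
  by rewrite addn0 in l_dl; case: (crossing_absent d2 lt_bc (or_introl l_dl) ks2 sc).
case: dr r_dr => [|dr] r_dr.
  by rewrite addn0 in r_dr; case: (crossing_absent d1 lt_ab (or_intror r_dr) ks1 s1b).
rewrite ss size_cat addSn expnS mul2n -addnn leq_add //.
  by apply: IH1 d1 _ r_dr ks1 s1b; rewrite addSnnS.
by rewrite -addSnnS; apply: IH2 d2 l_dl _ ks2 sc; rewrite addSnnS.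
Qed.

Lemma residue_reached l : exists2 d, d <= K & (l + d) %% K = i.
Proof.
have K_gt0 : 0 < K by lia.
exists ((i + (K - l %% K)) %% K); first exact/ltnW/ltn_pmod.
rewrite modnDmr addnCA.
have -> : i + (l + (K - l %% K)) = (l %/ K).+1 * K + i.
  by have := divn_eq l K; have := ltn_pmod l K_gt0; lia.
by rewrite modnMDl modn_small.
Qed.

Lemma size_crossing t l r a c s : dissects a c t ->
  path (kept l r t a c) a s -> last a s = c -> size s <= 2 ^ (K + K).
Proof.
move=> dt ks sc; have [dl le_dl l_dl] := residue_reached l.
have [dr le_dr r_dr] := residue_reached r.
apply: leq_trans (size_crossing_exp dt l_dl r_dr ks sc) _.
by rewrite leq_exp2l // leq_add.
Qed.

(* The last edge of a path to [c] has made no further left turn, and the first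
   edge of a path from [a] no further right turn. *)
Lemma size_suffix_prefix t l r a c p s : dissects a c t -> a <= p ->
    last p s <= c -> path (kept l r t a c) p s ->
  (forall d, (l + d) %% K = i -> last p s = c -> size s <= d * 2 ^ (K + K)) /\
  (forall d, (r + d) %% K = i -> p = a -> size s <= d * 2 ^ (K + K)).
Proof.
set B := 2 ^ (K + K); have B_gt0 : 0 < B by rewrite expn_gt0.
have one_le k d : k %% K != i -> (k + d) %% K = i -> 1 <= d * B.
  by case: d => [|d]; [rewrite addn0 => /eqP | rewrite muln_gt0 B_gt0].
elim: t l r a c p s => [|b t1 IH1 t2 IH2] l r a c p s dt le_ap le_c ks.
  case: (kept_path_undivided dt le_ap le_c ks) => [-> //|[_ -> /kept_root[nl nr]]].
  by split=> d kd _; [apply: one_le nl kd | apply: one_le nr kd].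
have [/andP[lt_ab lt_bc] _ d1 d2] := dt.
case: (kept_path_divided dt le_ap le_c ks)
    => [[le_b ks1]|[le_bp ks2]|[_ -> /kept_root[nl nr]]|[s1 [s2 [ss s1b ks1 ks2]]]].
- have [_ pre] := IH1 _ _ _ _ _ _ d1 le_ap le_b ks1; split=> // d _ sc.
  by rewrite sc leqNgt lt_bc in le_b.
- have [suf _] := IH2 _ _ _ _ _ _ d2 le_bp le_c ks2; split=> // d _ pa.
  by rewrite pa leqNgt lt_ab in le_bp.
- by split=> d kd _; [apply: one_le nl kd | apply: one_le nr kd].
rewrite {s ks}ss last_cat s1b size_cat in le_c *.
have [suf1 _] := IH1 _ _ _ _ _ _ d1 le_ap (eq_leq s1b) ks1.
have [_ pre2] := IH2 _ _ _ _ _ _ d2 (leqnn b) le_c ks2.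
split=> [[|d] kd s2c|[|d] kd pa].
- by rewrite addn0 in kd; case: (crossing_absent d2 lt_bc (or_introl kd) ks2 s2c).
- rewrite mulSn addnC leq_add ?(size_crossing d2 ks2) //.
  by apply: suf1 s1b; rewrite addSnnS.
- rewrite pa addn0 in kd ks1 s1b.
  by case: (crossing_absent d1 lt_ab (or_intror kd) ks1 s1b).
- rewrite pa in ks1 s1b; rewrite mulSn leq_add ?(size_crossing d1 ks1) //.
  by apply: pre2; rewrite ?addSnnS.
Qed.

Lemma size_kept_path t l r a c p s : dissects a c t -> a <= p -> last p s <= c ->
  path (kept l r t a c) p s -> size s <= 2 * (K * 2 ^ (K + K)).
Proof.
have B_gt0 : 0 < 2 * (K * 2 ^ (K + K)) by rewrite !muln_gt0 expn_gt0 (leq_trans _ lt_iK).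
elim: t l r a c p s => [|b t1 IH1 t2 IH2] l r a c p s dt le_ap le_c ks.
  by case: (kept_path_undivided dt le_ap le_c ks) => [->|[_ -> _]].
have [_ _ d1 d2] := dt.
case: (kept_path_divided dt le_ap le_c ks)
    => [[le_b ks1]|[le_bp ks2]|[_ -> _] //|[s1 [s2 [ss s1b ks1 ks2]]]].
- exact: IH1 d1 le_ap le_b ks1.
- exact: IH2 d2 le_bp le_c ks2.
rewrite {s ks}ss last_cat s1b size_cat in le_c *.
have [dl le_dl l_dl] := residue_reached l.+1; have [dr le_dr r_dr] := residue_reached r.+1.
have [suf _] := size_suffix_prefix d1 le_ap (eq_leq s1b) ks1.
have [_ pre] := size_suffix_prefix d2 (leqnn b) le_c ks2.
rewrite mul2n -addnn leq_add //.
  by apply: leq_trans (suf _ l_dl s1b) _; rewrite leq_mul2r le_dl orbT.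
by apply: leq_trans (pre _ r_dr erefl) _; rewrite leq_mul2r le_dr orbT.
Qed.

End Noncrossing.

Definition noncrossing_height K := 2 * (K * 2 ^ (K + K)).

Lemma noncrossing_depth_reducible (e : rel nat) K c :
    (forall p q, e p q -> p < q) -> noncrossing e ->
  depth_reducible K 2 (noncrossing_height K) c e.
Proof.
move=> e_lt e_nc; have [t dt] := noncrossing_dissection e_nc 0 c.
exists (fun i p q => ((turns t 0 c p q).1 %% K == i) || ((turns t 0 c p q).2 %% K == i)).
split=> [p q|i lt_iK].
  have count_residue x : \sum_(i < K) (x %% K == i) <= 1.
    by apply: sum_exclusive_le1 => i j lt_ij /eqP->; rewrite ltn_eqF.
  apply: leq_trans (leq_add (count_residue (turns t 0 c p q).1)
    (count_residue (turns t 0 c p q).2)).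
  by rewrite -big_split; apply: leq_sum => i _; do 2!case: (_ == _).
have [|rho [rhoT rho_lt]] := @longest_path_rank (kept e K i 0 0 t 0 c) c
  (noncrossing_height K) (@kept_lt _ e_lt _ _ _ _ _ _ _).
  by move=> p s ks le_c; apply: (size_kept_path e_lt lt_iK dt _ le_c ks).
exists rho; split=> // p q le_qc epq; rewrite -implyNb negb_or.
by apply/implyP=> /andP[nl nr]; apply: rho_lt; rewrite // /kept epq nl.
Qed.

Section DeleteDigit.
Variables (B i : nat).
Hypothesis B_gt0 : 0 < B.

(* Removes the digit of weight [B ^ i] from the base-[B] expansion. *)
Definition delete_digit x := x %/ B ^ i.+1 * B ^ i + x %% B ^ i.

Lemma delete_digit_lt x y : x < y ->
  x %/ B ^ i.+1 != y %/ B ^ i.+1 \/ x %/ B ^ i = y %/ B ^ i ->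
  delete_digit x < delete_digit y.
Proof.
have Bi_gt0 : 0 < B ^ i by rewrite expn_gt0 B_gt0.
move=> lt_xy; rewrite /delete_digit => -[ne|eq_i].
  have lt_d : x %/ B ^ i.+1 < y %/ B ^ i.+1 by rewrite ltn_neqAle ne leq_div2r // ltnW.
  apply: leq_trans (leq_addr _ _).
  apply: (@leq_trans ((x %/ B ^ i.+1).+1 * B ^ i)); last by rewrite leq_mul2r lt_d orbT.
  by rewrite mulSn addnC ltn_add2r ltn_pmod.
rewrite expnSr !divnMA eq_i ltn_add2l.
by move: lt_xy; rewrite {1}(divn_eq x (B ^ i)) {1}(divn_eq y (B ^ i)) eq_i ltn_add2l.
Qed.

Lemma delete_digit_le K X x : i <= K -> x < X * B ^ K.+1 ->
  delete_digit x <= X * B ^ K.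
Proof.
move=> le_iK lt_x; have Bi_gt0 : 0 < B ^ i by rewrite expn_gt0 B_gt0.
have lt_d : x %/ B ^ i.+1 < X * B ^ (K - i).
  by rewrite ltn_divLR ?expn_gt0 ?B_gt0 // -mulnA -expnD addnS subnK.
apply: (@leq_trans ((x %/ B ^ i.+1).+1 * B ^ i)).
  by rewrite /delete_digit mulSn addnC leq_add2r ltnW ?ltn_pmod.
by rewrite -[in leqRHS](subnK le_iK) expnD mulnA leq_mul2r lt_d orbT.
Qed.

End DeleteDigit.

(* Valiant's depth reduction: an edge is in class [i] when the most significant
   digit in which its endpoints differ is the [i]-th. *)
Lemma ltn_depth_reducible K B X c : 0 < B -> c < X * B ^ K.+1 ->
  depth_reducible K.+1 1 (X * B ^ K) c ltn.
Proof.
move=> B_gt0 lt_c.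
pose cls i p q := (p %/ B ^ i.+1 == q %/ B ^ i.+1) && (p %/ B ^ i != q %/ B ^ i).
exists cls; split=> [p q|i le_iK].
  apply: (@sum_exclusive_le1 _ (fun i => cls i p q)) => i j lt_ij /andP[/eqP eq_i _].
  by rewrite negb_and negbK -(subnKC lt_ij) expnD !divnMA eq_i eqxx orbT.
exists (delete_digit B i); split=> [q le_qc|p q _ lt_pq].
  exact: delete_digit_le (leq_ltn_trans le_qc lt_c).
rewrite -implyNb /cls negb_and negbK; apply/implyP=> differ.
by apply: delete_digit_lt => //; case/orP: differ => [|/eqP]; [left|right].
Qed.

End DepthReduction.

(** * Circuits *)

Section FoldRcons.
Variables (T G : Type) (h : seq T -> G -> T) (x0 : T) (g0 : G).
Let F (s : seq T) g := rcons s (h s g).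
Local Open Scope nat_scope.

Lemma size_foldl_rcons s gs : size (foldl F s gs) = size s + size gs.
Proof. by elim: gs s => [|g gs IH] s /=; rewrite ?addn0 // IH size_rcons addSnnS. Qed.

Lemma nth_foldl_rcons s gs j : j < size s -> nth x0 (foldl F s gs) j = nth x0 s j.
Proof.
elim: gs s => //= g gs IH s lt_j; rewrite IH ?size_rcons 1?ltnW //.
by rewrite nth_rcons lt_j.
Qed.

Lemma nth_foldl_rconsE s gs i : i < size gs ->
  nth x0 (foldl F s gs) (size s + i) =
  h (foldl F s (take i gs)) (nth g0 gs i).
Proof.
move=> lt_i; rewrite -{1}(cat_take_drop i gs) (drop_nth g0) // foldl_cat /=.
set s' := foldl F s (take i gs).
have s's : size s' = size s + i by rewrite size_foldl_rcons size_takel // ltnW.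
rewrite nth_foldl_rcons /F; last by rewrite size_rcons s's.
by rewrite nth_rcons s's ltnn eqxx.
Qed.

Lemma nth_foldl_rcons_take s gs i j : j < size s + i -> i <= size gs ->
  nth x0 (foldl F s (take i gs)) j = nth x0 (foldl F s gs) j.
Proof.
move=> lt_j le_i; rewrite -{2}(cat_take_drop i gs) foldl_cat.
by rewrite [RHS]nth_foldl_rcons // size_foldl_rcons size_takel.
Qed.

End FoldRcons.

Section Circuit.
Variables (n : nat) (C : circuit n).
Local Open Scope nat_scope.

Definition gate_at j := nth (Gate andb 0 0) (gates C) (j - n).
Definition value j x := nth false (circuit_values C x) j.
Definition depth j := nth 0 (circuit_depths C) j.
Definition is_gate j := n <= j < n + circuit_size C.
Definition gate_wires j := [:: gate_l (gate_at j); gate_r (gate_at j)].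
Definition wires : seq (nat * nat) :=
  [seq (u, j) | j <- iota n (circuit_size C), u <- gate_wires j].

Lemma mem_wires u j : ((u, j) \in wires) = is_gate j && (u \in gate_wires j).
Proof.
apply/allpairsPdep/andP => [[j' [u' [+ ru [-> ->]]]]|[gj uj]]; rewrite ?mem_iota //.
by exists j, u; rewrite mem_iota.
Qed.

Lemma size_wires : size wires = 2 * circuit_size C.
Proof.
rewrite /wires size_allpairs_dep -[in RHS](size_iota n (circuit_size C)).
by elim: (iota _ _) => //= j s ->; rewrite mulnS.
Qed.

Lemma wires_gate j : is_gate j ->
  (gate_l (gate_at j), j) \in wires /\ (gate_r (gate_at j), j) \in wires.
Proof. by move=> gj; rewrite !mem_wires gj !inE !eqxx orbT. Qed.

Lemma onth_gate j : is_gate j -> onth (gates C) (j - n) = Some (gate_at j).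
Proof.
rewrite /is_gate /circuit_size => /andP[le_nj lt_j].
by rewrite /gate_at onthE (nth_map (Gate andb 0 0)) // ltn_subLR.
Qed.

Lemma wire_lt u j : (u, j) \in wires -> u < j.
Proof.
rewrite mem_wires => /andP[gj]; have [le_nj _] := andP gj.
have [] := gates_acyclic (onth_gate gj); rewrite subnKC // !inE.
by move=> ? ? /orP[]/eqP->.
Qed.

Lemma wire_vertex_lt u j : (u, j) \in wires ->
  u < n + circuit_size C /\ j < n + circuit_size C.
Proof.
move=> uj; have lt_uj := wire_lt uj; move: uj; rewrite mem_wires.
by case/andP=> /andP[_ lt_j] _; split=> //; apply: ltn_trans lt_j.
Qed.

Lemma value_input (i : 'I_n) x : value i x = tnth x i.
Proof.
rewrite /value /circuit_values (nth_foldl_rcons _ false) ?size_tuple //.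
by rewrite (tnth_nth false).
Qed.

Lemma value_gate j x : is_gate j -> value j x =
  gate_op (gate_at j) (value (gate_l (gate_at j)) x) (value (gate_r (gate_at j)) x).
Proof.
move=> gj; have [/wire_lt lt_l /wire_lt lt_r] := wires_gate gj.
have /andP[le_nj lt_j] := gj.
have lt_s : j - n < size (gates C) by rewrite ltn_subLR.
pose h vs g := gate_op g (nth false vs (gate_l g)) (nth false vs (gate_r g)).
have := nth_foldl_rconsE h false (Gate andb 0 0) x lt_s.
rewrite size_tuple subnKC // -/(gate_at j) /value /circuit_values => ->.
by rewrite {1}/h !(nth_foldl_rcons_take h false) ?size_tuple ?subnKC // ltnW.
Qed.

Lemma depth_wire u j : (u, j) \in wires -> depth u < depth j.
Proof.
move=> uj; move: (uj); rewrite mem_wires => /andP[gj].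
have [/wire_lt lt_l /wire_lt lt_r] := wires_gate gj.
have /andP[le_nj lt_j] := gj.
have lt_s : j - n < size (gates C) by rewrite ltn_subLR.
pose h ds g := (maxn (nth 0 ds (gate_l g)) (nth 0 ds (gate_r g))).+1.
have := nth_foldl_rconsE h 0 (Gate andb 0 0) (nseq n 0) lt_s.
rewrite size_nseq subnKC // -/(gate_at j) /depth /circuit_depths => ->.
rewrite {1}/h !(nth_foldl_rcons_take h 0) ?size_nseq ?subnKC // ?(ltnW lt_s) //.
by rewrite !inE ltnS leq_max => /orP[]/eqP->; rewrite leqnn ?orbT.
Qed.

Lemma wire_edge (u v : vertex C) : (u : nat, v : nat) \in wires -> edge u v.
Proof.
rewrite mem_wires => /andP[gv]; rewrite !inE => u_wire.
exists (v - n), (gate_at v); split; first exact: onth_gate.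
  by rewrite subnKC //; case/andP: gv.
by case/orP: u_wire => /eqP; [left|right].
Qed.

Lemma low_degree_value_input j : j < n -> low_degree 1 (value j).
Proof.
move=> lt_jn; have := low_degree_var (Ordinal lt_jn).
by congr low_degree; apply/funext => x; rewrite -value_input.
Qed.

Lemma low_degree_on_gate S d1 d2 j : is_gate j ->
    low_degree_on S d1 (value (gate_l (gate_at j))) ->
    low_degree_on S d2 (value (gate_r (gate_at j))) ->
  low_degree_on S (d1 + d2) (value j).
Proof.
by move=> gj l1 l2; apply: low_degree_on_op l1 l2 (fun x _ => value_gate x gj).
Qed.

Variable f : boolfun n.
Hypothesis Cf : computes C f.

Lemma subcircuit_of_circuit : exists C' : subcircuit
    (fun j : 'I_(n + circuit_size C) => value j) f xpredT,
  live C' = [set j : 'I_(n + circuit_size C) | n <= j].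
Proof.
pose N := n + circuit_size C; pose A := [set j : 'I_N | n <= j].
have availA j : available n A j by rewrite /available inE; case: ltnP.
have /choice[g gP] (j : 'I_N) : exists t : 'I_N * 'I_N, n <= j ->
    [/\ t.1 = gate_l (gate_at j) :> nat, t.2 = gate_r (gate_at j) :> nat & is_gate j].
  have [le_nj|//] := boolP (n <= j); last by exists (j, j).
  have gj : is_gate j by rewrite /is_gate le_nj ltn_ord.
  have [/wire_vertex_lt[lt_l _] /wire_vertex_lt[lt_r _]] := wires_gate gj.
  by exists (Ordinal lt_l, Ordinal lt_r).
unshelve eexists (@Subcircuit n N (fun j => value j) f xpredT A
  (fun j => gate_op (gate_at j)) (fun j => (g j).1) (fun j => (g j).2)
  (Ordinal (output_lt C)) id _ _ (availA _) _) => //.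
- move=> j; rewrite inE => le_nj; have [el er gj] := gP j le_nj.
  have [/wire_lt lt_l /wire_lt lt_r] := wires_gate gj.
  by rewrite el er; split; rewrite ?availA.
- move=> j x; rewrite inE => le_nj _; have [-> -> gj] := gP j le_nj.
  exact: value_gate.
- by move=> x _; rewrite -Cf.
Qed.

Lemma card_gate_vertices :
  #|[set j : 'I_(n + circuit_size C) | n <= j]| = circuit_size C.
Proof.
rewrite -sum1_card big_mkcond big_split_ord /= big1 ?add0n => [|i _]; last first.
  by rewrite inE leqNgt /= ltn_ord.
rewrite (eq_bigr (fun=> 1)) ?sum1_card ?card_ord // => i _.
by rewrite inE leq_addr.
Qed.

End Circuit.

Lemma card_bits (R : realType) n :
  #|(xpredT : pred (n.-tuple bool))|%:R = 2 ^+ n :> R.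
Proof. by rewrite card_tuple card_bool natrX. Qed.

Lemma circuit_size_budget (R : realType) n (C : circuit n) f (M : R) :
    computes C f -> correlation_bound f 12 M ->
  2 ^+ n <= budget (circuit_size C)%:R * M.
Proof.
move=> Cf fM; have [C' live_C'] := subcircuit_of_circuit Cf.
have := card_subcircuit_le fM (fun j => @low_degree_value_input n C j) C' (polysetT _ _).
by rewrite /within_budget live_C' card_gate_vertices card_bits.
Qed.

Section RankedCut.
Variables (R : realType) (n : nat) (C : circuit n) (f : boolfun n).
Variables (d T : nat) (M : R) (Q : pred nat) (G : seq nat) (rho : nat -> nat).
Hypotheses (Cf : computes C f) (fM : correlation_bound f d M) (le_2T : (2 ^ T <= d)%N).
Hypothesis Q_output : Q (output C).
Hypothesis Q_vertex : forall j, Q j -> (j < n + circuit_size C)%N.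
Hypothesis Q_wire : forall u j, (u, j) \in wires C -> Q j -> Q u.
Hypothesis rho_le : forall j, Q j -> (rho j <= T)%N.
Hypothesis GQ : {subset G <= Q}.
Hypothesis rho_lt : forall u j, (u, j) \in wires C -> Q j ->
  u \in G \/ (rho u < rho j)%N.

Lemma low_degree_rank S j : Q j ->
    (forall u, u \in G -> (u < j)%N -> const_on S (value C u)) ->
  low_degree_on S (2 ^ rho j) (value C j).
Proof.
have [m] := ubnP j; elim: m j => // m IHm j lt_jm Qj const_G.
have [lt_jn|le_nj] := ltnP j n.
  apply: low_degree_onW (low_degree_onT S (low_degree_value_input C lt_jn)).
  by rewrite expn_gt0.
have gj : is_gate C j by rewrite /is_gate le_nj Q_vertex.
have low_wire u : (u, j) \in wires C -> low_degree_on S (2 ^ rho j)./2 (value C u).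
  move=> uj; have lt_uj := wire_lt uj.
  have [uG|lt_rho] := rho_lt uj Qj; first exact/low_degree_on_cst/const_G.
  apply: low_degree_onW (IHm u _ (Q_wire uj Qj) _).
  - by rewrite geq_half_double -mul2n -expnS leq_exp2l.
  - exact: leq_trans lt_uj _.
  - by move=> w wG lt_wu; apply: const_G (ltn_trans lt_wu lt_uj).
have [lj rj] := wires_gate gj.
apply: low_degree_onW (low_degree_on_gate gj (low_wire _ lj) (low_wire _ rj)).
by rewrite addnn -geq_half_double.
Qed.

Lemma low_degree_below_cut S j : Q j ->
    (forall u, u \in G -> (u < j)%N -> const_on S (value C u)) ->
  low_degree_on S d (value C j).
Proof.
move=> Qj /(low_degree_rank Qj); apply: low_degree_onW.
by apply: leq_trans le_2T; rewrite leq_exp2l // rho_le.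
Qed.

(* The gates of the cut are guessed in topological order. *)
Lemma card_cut_le (s : seq nat) S : sorted leq s -> {subset s <= G} -> polyset d S ->
    (forall u, u \in G -> u \notin s -> const_on S (value C u)) ->
  #|S|%:R <= 2 ^+ size s * M.
Proof.
elim: s S => [|m s IHs] S.
  move=> _ _ pS const_G; rewrite mul1r; apply: card_polyset_le fM pS _.
  have [|h lh vh] := @low_degree_below_cut S _ Q_output.
    by move=> u uG _; apply: const_G.
  by exists h => // x Sx; rewrite -vh // -Cf.
move=> ms sG pS const_G.
have m_le : all (leq m) s by rewrite order_path_min //; apply: leq_trans.
have low_m : low_degree_on S d (value C m).
  apply: low_degree_below_cut => [|u uG lt_um]; first by apply/GQ/sG; rewrite mem_head.
  apply: const_G => //; rewrite in_cons ltn_eqF //=.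
  by apply/negP=> /(allP m_le); rewrite leqNgt lt_um.
rewrite (card_guess S (value C m)) natrD exprS -mulrA mulrDl mul1r.
have guess_le b : #|guess S (value C m) b|%:R <= 2 ^+ size s * M.
  apply: IHs (path_sorted ms) _ (polyset_guess b pS low_m) _.
    by move=> u us; apply: sG; rewrite in_cons us orbT.
  move=> u uG us; have [->|ne_um] := eqVneq u m; first exact: guess_const.
  have [|c vu] := const_G u uG; first by rewrite in_cons negb_or ne_um.
  by exists c => x /guess_sub; apply: vu.
exact: lerD.
Qed.

Lemma cut_bound : 2 ^+ n <= 2 ^+ size G * M.
Proof.
rewrite -(card_bits R n) -(size_sort leq G); apply: card_cut_le.
- exact: sort_sorted leq_total _.
- by move=> u; rewrite mem_sort.
- exact: polysetT.
- by move=> u uG; rewrite mem_sort uG.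
Qed.

End RankedCut.

Lemma exists_le_average K (a : nat -> nat) s : (0 < K)%N ->
  (\sum_(i < K) a i <= s)%N -> exists2 i, (i < K)%N & (K * a i <= s)%N.
Proof.
case: K => // K _ le_s.
have [//|i _ i_min] := @arg_minnP _ ord0 xpredT (fun i : 'I_K.+1 => a i).
exists i => //; apply: leq_trans le_s.
by rewrite -{1}(card_ord K.+1) -sum_nat_const leq_sum // => j _; apply: i_min.
Qed.

Lemma depth_reducible_cut (R : realType) n (C : circuit n) f (M : R)
    K w T c (e : rel nat) (label : nat -> nat) :
    computes C f -> correlation_bound f (2 ^ T) M -> (0 < K)%N ->
    depth_reducible K w T c e -> (forall p q, e p q -> (p < q)%N) ->
    (forall u j, (u, j) \in wires C -> e (label u) (label j)) ->
    (label (output C) <= c)%N ->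
  exists2 g, (K * g <= 2 * w * circuit_size C)%N & 2 ^+ n <= 2 ^+ g * M.
Proof.
move=> Cf fM K_gt0 [cls [cls_w cut]] e_lt label_wire label_output.
pose Q j := (j < n + circuit_size C)%N && (label j <= c)%N.
pose in_class i (uj : nat * nat) := cls i (label uj.1) (label uj.2).
pose G i := [seq uj.1 | uj <- wires C & Q uj.2 && in_class i uj].
have Q_wire u j : (u, j) \in wires C -> Q j -> Q u.
  move=> uj /andP[_ le_jc]; rewrite /Q (wire_vertex_lt uj).1 /=.
  exact: leq_trans (ltnW (e_lt _ _ (label_wire _ _ uj))) le_jc.
have [i lt_iK le_G] : exists2 i, (i < K)%N &
    (K * size (G i) <= 2 * w * circuit_size C)%N.
  apply: exists_le_average => //.
  under eq_bigr => i _ do rewrite size_map size_filter -sum1_count big_mkcond.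
  rewrite exchange_big /= mulnAC -size_wires -sum1_size big_distrl /=.
  apply: leq_sum => uj _; rewrite mul1n.
  apply: leq_trans (cls_w (label uj.1) (label uj.2)).
  by apply: leq_sum => i _; rewrite /in_class; case: (Q _); case: (cls _ _ _).
exists (size (G i)) => //; have [rho [rho_le rho_lt]] := cut i lt_iK.
apply: (cut_bound (Q := Q) (rho := rho \o label) Cf fM (leqnn _)) => //.
- by rewrite /Q (output_lt C).
- by move=> j /andP[].
- by move=> j /andP[_]; apply: rho_le.
- move=> u /mapP[[u' j]]; rewrite mem_filter => /andP[/andP[Qj _] uj] ->.
  exact: Q_wire uj Qj.
move=> u j uj Qj; have /andP[_ le_jc] := Qj.
have /orP[cls_uj|] := rho_lt _ _ le_jc (label_wire _ _ uj); [left | by right].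
by apply/mapP; exists (u, j) => //; rewrite mem_filter Qj uj /in_class cls_uj.
Qed.

Lemma series_parallel_cut (R : realType) n (C : circuit n) f (M : R) K :
    computes C f -> series_parallel C -> (0 < K)%N ->
    correlation_bound f (2 ^ noncrossing_height K) M ->
  exists2 g, (K * g <= 4 * circuit_size C)%N & 2 ^+ n <= 2 ^+ g * M.
Proof.
move=> Cf [l [l_lt l_nc]] K_gt0 fM.
pose label j := if insub j is Some u then l u else 0%N.
pose e p q := `[< exists u v : vertex C, [/\ edge u v, l u = p & l v = q] >].
have e_lt p q : e p q -> (p < q)%N.
  by case/asboolP=> u [v [uv <- <-]]; apply: l_lt.
have e_nc : noncrossing e.
  move=> p q p' q' /asboolP[u [v [uv <- <-]]] /asboolP[u' [v' [uv' <- <-]]].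
  by apply/negP=> /and3P[lt1 lt2 lt3]; apply: l_nc; exists u, v, u', v'.
apply: depth_reducible_cut Cf fM K_gt0
  (noncrossing_depth_reducible K (label (output C)) e_lt e_nc) e_lt _ (leqnn _).
move=> u j uj; have [lt_u lt_j] := wire_vertex_lt uj.
rewrite /label !insubT /=; apply/asboolP.
by exists (Ordinal lt_u), (Ordinal lt_j); split=> //; apply: wire_edge.
Qed.

Lemma depth_cut (R : realType) n (C : circuit n) f (M : R) K X B :
    computes C f -> (0 < B)%N -> (circuit_depth C < X * B ^ K.+1)%N ->
    correlation_bound f (2 ^ (X * B ^ K)) M ->
  exists2 g, (K.+1 * g <= 2 * circuit_size C)%N & 2 ^+ n <= 2 ^+ g * M.
Proof.
move=> Cf B_gt0 lt_depth fM.
exact: depth_reducible_cut Cf fM (ltn0Sn K) (ltn_depth_reducible B_gt0 lt_depth)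
  (fun p q => id) (@depth_wire n C) (leqnn _).
Qed.

(** * Asymptotics *)

Local Open Scope classical_set_scope.
Local Open Scope ring_scope.

Section CorrelationSize.
Variable R : realType.
Implicit Types (y r eps : R).

Lemma exprn_powR2 (k : nat) : 2 ^+ k = 2 `^ k%:R :> R.
Proof. by rewrite powR_mulrn. Qed.

Lemma correlation_exponent n (cor g y : R) :
  2 ^+ n <= 2 `^ g * (2 ^+ n * cor) -> cor <= 2 `^ (- y) -> y <= g.
Proof.
move=> le_n le_cor; have p2 : 0 < 2 ^+ n :> R by rewrite exprn_gt0.
have : 1 <= 2 `^ (g - y).
  rewrite powRD ?pnatr_eq0 ?implybT //.
  apply: le_trans (_ : _ <= 2 `^ g * cor) _; last by rewrite ler_wpM2l ?powR_ge0.
  by rewrite -(ler_pM2l p2) mulr1 mulrCA.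
by move/ln_ge0; rewrite ln_powR pmulr_lge0 ?ln_gt0 ?ltr1n // subr_ge0.
Qed.

Lemma cut_size_ge n (f : boolfun n) r y (K m : nat) :
    (exists2 g, (K * g <= m)%N & 2 ^+ n <= 2 ^+ g * (2 ^+ n * Cor_deg f r)) ->
  Cor_deg f r <= 2 `^ (- y) -> K%:R * y <= m%:R.
Proof.
case=> g le_m; rewrite (exprn_powR2 g) => /correlation_exponent le_g /le_g le_y.
apply: (@le_trans _ _ (K%:R * g%:R)); first by rewrite ler_wpM2l.
by rewrite -natrM ler_nat.
Qed.

Lemma min_circuit_size_ge_of_Cor_deg eps n (f : boolfun n) r : 12 <= r ->
    Cor_deg f r <= 2 `^ (- (n%:R * (1 - eps))) ->
  ((39 / 10 * (1 - eps) * n%:R - 4)%:E <= min_circuit_size R f)%E.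
Proof.
move=> r_ge12 le_cor; apply/ereal_infP => _ [C Cf <-]; rewrite lee_fin.
have fM := correlation_bound_Cor_deg f r_ge12.
by have := correlation_exponent (circuit_size_budget Cf fM) le_cor; lra.
Qed.

Lemma series_parallel_size_ge n (C : circuit n) f K r y :
    computes C f -> series_parallel C -> (0 < K)%N ->
    (2 ^ noncrossing_height K)%:R <= r -> Cor_deg f r <= 2 `^ (- y) ->
  K%:R * y <= 4 * (circuit_size C)%:R.
Proof.
move=> Cf Csp K_gt0 /correlation_bound_Cor_deg fM le_cor.
by have := cut_size_ge (series_parallel_cut Cf Csp K_gt0 (fM n f)) le_cor; rewrite natrM.
Qed.

Lemma bounded_depth_size_ge n (C : circuit n) f K X B r y :
    computes C f -> (0 < B)%N -> (circuit_depth C < X * B ^ K.+1)%N ->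
    (2 ^ (X * B ^ K))%:R <= r -> Cor_deg f r <= 2 `^ (- y) ->
  K.+1%:R * y <= 2 * (circuit_size C)%:R.
Proof.
move=> Cf B_gt0 lt_depth /correlation_bound_Cor_deg fM le_cor.
by have := cut_size_ge (depth_cut Cf B_gt0 lt_depth (fM n f)) le_cor; rewrite natrM.
Qed.

End CorrelationSize.

Section Log2.
Variable R : realType.
Implicit Types (x y z : R).

Lemma log2K x : 0 < x -> 2 `^ log2 x = x.
Proof.
move=> x_gt0; rewrite /powR pnatr_eq0 /= /log2 divfK ?lnK ?posrE //.
by rewrite gt_eqF ?ln_gt0 ?ltr1n.
Qed.

Lemma powR2K x : log2 (2 `^ x) = x.
Proof. by rewrite /log2 ln_powR mulfK // gt_eqF ?ln_gt0 ?ltr1n. Qed.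

Lemma ler_log2 x y : 0 < x -> x <= y -> log2 x <= log2 y.
Proof.
move=> x_gt0 le_xy; rewrite ler_pM2r ?invr_gt0 ?ln_gt0 ?ltr1n // ler_ln ?posrE //.
exact: lt_le_trans le_xy.
Qed.

Lemma log2X x k : 0 < x -> log2 (x ^+ k) = k%:R * log2 x.
Proof. by move=> x_gt0; rewrite /log2 lnXn // -(mulr_natl (ln x) k) mulrA. Qed.

Lemma log2_gt0 x : 1 < x -> 0 < log2 x.
Proof. by move=> x_gt1; rewrite divr_gt0 ?ln_gt0 ?ltr1n. Qed.

Lemma log2_unbounded z : \forall n \near \oo, z <= log2 n%:R.
Proof.
apply: filterS (nbhs_infty_ger (2 `^ z)) => n le_n.
by rewrite -(powR2K z) ler_log2 ?powR_gt0.
Qed.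

End Log2.

Section Superlinear.
Variable R : realType.
Implicit Types (z c eps : R) (f : forall n, boolfun n).

Lemma exists_natS_mul_gt eps c : 0 < eps -> exists K : nat, c < K.+1%:R * eps.
Proof.
move=> eps_gt0; exists (Num.bound `|c / eps|); rewrite -ltr_pdivrMr //.
apply: le_lt_trans (ler_norm _) (lt_trans (archi_boundP (normr_ge0 _)) _).
by rewrite ltr_nat.
Qed.

Lemma ssp_superlinear_of_Cor_deg eps f : 0 < eps ->
    (forall d : nat, \forall n \near \oo,
       Cor_deg (f n) d%:R <= 2 `^ (- (eps * n%:R))) ->
  ssp_superlinear R f.
Proof.
move=> eps_gt0 cor c; have [K lt_K] := exists_natS_mul_gt (4 * c) eps_gt0.
apply: filterS2 (cor (2 ^ noncrossing_height K.+1)%N) (nbhs_infty_gt 0) => n le_cor n_gt0.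
case=> C [Cf Csp le_s].
have le_n := series_parallel_size_ge Cf Csp (ltn0Sn K) (lexx _) le_cor.
have : 4 * c * n%:R < K.+1%:R * eps * n%:R by rewrite ltr_pM2r ?ltr0n.
lra.
Qed.

Lemma slog_superlinear_ge1 f :
    (forall c, 1 <= c -> \forall n \near \oo, ~ exists C : circuit n,
       [/\ computes C (f n), (circuit_size C)%:R <= c * n%:R
         & (circuit_depth C)%:R <= c * log2 n%:R]) ->
  slog_superlinear R f.
Proof.
move=> f_hard c; pose c' := Num.max 1 c.
have [c'_ge1 le_cc'] : 1 <= c' /\ c <= c' by rewrite /c' !le_max !lexx orbT.
apply: filterS2 (f_hard c' c'_ge1) (log2_unbounded (0 : R)) => n no_circuit log_ge0.
case=> C [Cf le_s le_d]; apply: no_circuit; exists C; split=> //.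
  by apply: le_trans le_s _; rewrite ler_wpM2r.
by apply: le_trans le_d _; rewrite ler_wpM2r.
Qed.

Lemma exists_root_base c z k : 1 <= c -> 1 <= z -> (2 ^+ k.+1 * c) ^+ (2 * k) <= z ->
  exists B : nat, [/\ (0 < B)%N, c * z < B%:R ^+ k.+1
    & B%:R ^+ k <= z `^ (1 - (2 * k.+1%:R)^-1)].
Proof.
move=> c_ge1 z_ge1 z_ge; have cz_ge1 : 1 <= c * z by rewrite mulr_ege1.
have z_ge0 : 0 <= z by lra.
pose w := (c * z) `^ k.+1%:R^-1; have w_ge0 : 0 <= w by rewrite powR_ge0.
have wX : w ^+ k.+1 = c * z.
  by rewrite -powR_mulrn // -powRrM mulVf ?powRr1 ?pnatr_eq0 //; lra.
have w_ge1 : 1 <= w by rewrite -(@ler_pXn2r _ k.+1) ?nnegrE // expr1n wX.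
have /andP[le_w lt_w] := truncn_itv w_ge0; pose B := (Num.truncn w).+1.
have le_B : B%:R <= 2 * w by rewrite /B -natr1; lra.
exists B; split=> //; first by rewrite -wX ltrXn2r.
rewrite -(@ler_pXn2r _ (2 * k.+1)) ?nnegrE ?powR_ge0 ?exprn_ge0 //.
have -> : (z `^ (1 - (2 * k.+1%:R)^-1)) ^+ (2 * k.+1) = z * z ^+ (2 * k).
  rewrite -powR_mulrn ?powR_ge0 // -powRrM -exprS -powR_mulrn //; congr (_ `^ _).
  by rewrite -natr1 !natrM -!natr1; field; rewrite natr1 pnatr_eq0.
apply: le_trans (_ : (2 ^+ k.+1 * c) ^+ (2 * k) * z ^+ (2 * k) <= _).
  rewrite -exprMn -[2 ^+ _ * c * z]mulrA -wX -exprMn -!exprM.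
  have -> : (k * (2 * k.+1) = k.+1 * (2 * k))%N by rewrite mulnCA mulnA mulnC.
  by rewrite lerXn2r ?nnegrE ?mulr_ge0.
by rewrite ler_wpM2r ?exprn_ge0.
Qed.

Lemma slog_superlinear_of_Cor_deg_exp eps f : 0 < eps ->
    (forall eta : R, 0 < eta -> \forall n \near \oo,
       Cor_deg (f n) (2 `^ (log2 n%:R `^ (1 - eta))) <= 2 `^ (- (eps * n%:R))) ->
  slog_superlinear R f.
Proof.
move=> eps_gt0 cor; apply: slog_superlinear_ge1 => c c_ge1.
have [k lt_k] := exists_natS_mul_gt (2 * c) eps_gt0.
have eta_gt0 : 0 < (2 * k.+1%:R)^-1 :> R by rewrite invr_gt0 mulr_gt0.
pose z0 := Num.max 1 ((2 ^+ k.+1 * c) ^+ (2 * k)).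
apply: filterS3 (cor _ eta_gt0) (nbhs_infty_gt 0) (log2_unbounded z0).
move=> n le_cor n_gt0; rewrite ge_max => /andP[z_ge1 z_ge] [C [Cf le_s le_d]].
have [B [B_gt0 lt_B le_B]] := exists_root_base c_ge1 z_ge1 z_ge.
have lt_depth : (circuit_depth C < 1 * B ^ k.+1)%N.
  by rewrite mul1n -(ltr_nat R) natrX (le_lt_trans le_d).
have le_2T : (2 ^ (1 * B ^ k))%:R <= 2 `^ (log2 n%:R `^ (1 - (2 * k.+1%:R)^-1)) :> R.
  by rewrite natrX exprn_powR2 ler_powR ?ler1n // mul1n natrX.
have le_n := bounded_depth_size_ge Cf B_gt0 lt_depth le_2T le_cor.
have : 2 * c * n%:R < k.+1%:R * eps * n%:R by rewrite ltr_pM2r ?ltr0n.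
lra.
Qed.

Lemma exists_exprn_itv (B : nat) z : (1 < B)%N -> B%:R <= z ->
  exists k, B%:R ^+ k.+1 <= z < B%:R ^+ k.+2.
Proof.
move=> B_gt1 z_ge; have z_ge0 : 0 <= z by apply: le_trans z_ge.
have m_ge : (B <= Num.truncn z)%N by rewrite truncn_ge_nat.
have /andP[le_m lt_m] := truncn_itv z_ge0.
have m_gt0 : (0 < Num.truncn z)%N by apply: leq_trans m_ge; apply: ltnW.
have := trunc_log_bounds B_gt1 m_gt0; case: (trunc_log _ _) => [|k] /andP[le_k lt_k].
  by rewrite expn1 ltnNge m_ge in lt_k.
exists k; rewrite -!natrX (le_trans _ le_m) ?ler_nat //=.
by apply: lt_le_trans lt_m _; rewrite ler_nat.
Qed.

Lemma ceil_digit_le (B D k : nat) c eps z : (0 < B)%N -> c + 1 <= B%:R * eps ->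
    D%:R <= c * z -> B%:R ^+ k.+1 <= z ->
  ((D %/ B ^ k.+1).+1 * B ^ k)%:R <= eps * z.
Proof.
move=> B_gt0 B_eps le_D le_z; set m := (_ * _)%N.
have z_ge0 : 0 <= z by apply: le_trans le_z; rewrite exprn_ge0.
have le_Bm : (B * m <= D + B ^ k.+1)%N.
  by rewrite /m mulnCA -expnS mulSn addnC leq_add2r leq_divM.
have : B%:R * m%:R <= (c + 1) * z.
  rewrite -natrM (le_trans (_ : _ <= (D + B ^ k.+1)%:R)) ?ler_nat //.
  by rewrite natrD natrX mulrDl mul1r lerD.
move/le_trans/(_ (ler_wpM2r z_ge0 B_eps)).
by rewrite -mulrA ler_pM2l // ltr0n.
Qed.

Lemma slog_superlinear_of_Cor_deg_poly eps f : 0 < eps ->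
    (forall C : R, 0 < C -> \forall n \near \oo,
       Cor_deg (f n) (n%:R `^ eps) <= 2 `^ (- (C * n%:R / log2 (log2 n%:R)))) ->
  slog_superlinear R f.
Proof.
move=> eps_gt0 cor; apply: slog_superlinear_ge1 => c c_ge1.
have [b lt_b] := exists_natS_mul_gt (c + 1) eps_gt0; pose B := b.+2.
have B_eps : c + 1 <= B%:R * eps by rewrite /B -(@natr1 _ b.+1) mulrDl mul1r; lra.
have logB_gt0 : 0 < log2 B%:R :> R by rewrite log2_gt0 ?ltr1n.
pose C0 := 4 * c * log2 B%:R + 1.
have cB_gt0 : 0 < c * log2 B%:R by rewrite mulr_gt0 // (lt_le_trans ltr01).
have C0_gt0 : 0 < C0 by rewrite /C0; lra.
apply: filterS3 (cor C0 C0_gt0) (nbhs_infty_gt 0) (log2_unbounded B%:R).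
move=> n le_cor n_gt0; set z := log2 n%:R in le_cor * => z_ge [C [Cf le_s le_d]].
have [k /andP[le_kz lt_zk]] := exists_exprn_itv (ltn0Sn b : (1 < B)%N) z_ge.
have n_gt0R : 0 < n%:R :> R by rewrite ltr0n.
pose X := (circuit_depth C %/ B ^ k.+1).+1.
have lt_depth : (circuit_depth C < X * B ^ k.+1)%N by rewrite ltn_ceil ?expn_gt0.
have le_T := ceil_digit_le (ltn0Sn _) B_eps le_d le_kz.
have le_2T : (2 ^ (X * B ^ k))%:R <= n%:R `^ eps :> R.
  by rewrite natrX exprn_powR2 -(log2K n_gt0R) -powRrM ler_powR ?ler1n // mulrC.
have le_n := bounded_depth_size_ge Cf (ltn0Sn _) lt_depth le_2T le_cor.
have w_gt0 : 0 < log2 z by rewrite log2_gt0 // (lt_le_trans _ z_ge) ?ltr1n.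
have le_w : log2 z <= k.+2%:R * log2 B%:R.
  by rewrite -log2X ?ltr0n // ler_log2 ?ltW // (lt_le_trans _ z_ge) ?ltr0n.
have le_C0 : k.+1%:R * C0 <= 2 * c * log2 z.
  have : k.+1%:R * (C0 * n%:R / log2 z) <= 2 * c * n%:R by lra.
  by rewrite mulrA ler_pdivrMr // mulrA [leRHS]mulrAC ler_pM2r.
have le_cw : 2 * c * log2 z <= 2 * c * (k.+2%:R * log2 B%:R).
  by rewrite ler_wpM2l ?mulr_ge0 //; lra.
have : 0 <= c * log2 B%:R * k%:R by rewrite mulr_ge0 // ltW.
have : 0 <= k%:R :> R by [].
move: (le_trans le_C0 le_cw); rewrite /C0 -(@natr1 _ k.+1) -(@natr1 _ k); lra.
Qed.

End Superlinear.

Theorem theorem12 (R : realType) (eps : R) (eps_gt0 : 0 < eps) :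
  (forall (n : nat) (f : boolfun n),
     Cor_deg f 16 <= 2 `^ (- (n%:R * (1 - eps))) ->
     ((39 / 10 * (1 - eps) * n%:R - 4)%:E <= min_circuit_size R f)%E)
  /\
  (forall f : forall n : nat, boolfun n,
     (forall d : nat, \forall n \near \oo,
        Cor_deg (f n) d%:R <= 2 `^ (- (eps * n%:R))) ->
     ssp_superlinear R f)
  /\
  (forall f : forall n : nat, boolfun n,
     (forall eta : R, 0 < eta -> \forall n \near \oo,
        Cor_deg (f n) (2 `^ (log2 n%:R `^ (1 - eta)))
          <= 2 `^ (- (eps * n%:R))) ->
     slog_superlinear R f)
  /\
  (forall f : forall n : nat, boolfun n,
     (forall C : R, 0 < C -> \forall n \near \oo,
        Cor_deg (f n) (n%:R `^ eps)
          <= 2 `^ (- (C * n%:R / log2 (log2 n%:R)))) ->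
     slog_superlinear R f).
Proof.
split; first by move=> n f; apply: min_circuit_size_ge_of_Cor_deg; lra.
split; first by move=> f; apply: ssp_superlinear_of_Cor_deg eps_gt0.
split=> f; first exact: slog_superlinear_of_Cor_deg_exp eps_gt0.
exact: slog_superlinear_of_Cor_deg_poly eps_gt0.
Qed.
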